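(* Let $P(M,G)$ be a reductive $G$-structure on a principal bundle $Q(M,H)$, with canonical embedding $i_P\colon P\to Q$ and canonical decomposition $i_P^{*}(TQ)=TP\oplus\mathcal M(P)$. Then the restriction $\Xi|_P$ to $P$ of an $H$-invariant vector field $\Xi$ on $Q$ splits into a $G$-invariant vector field $\Xi_{\mathrm K}$ on $P$ (called the generalized Kosmann vector field associated with $\Xi$) and a transverse vector field $\Xi_{\mathrm G}$ (called the generalized von Göden vector field associated with $\Xi$), i.e. a section of $\mathcal M(P)$.
   Context: Reductive Lie subgroup: a Lie subgroup $G$ of a Lie group $H$, with Lie algebras $\mathfrak g\subset\mathfrak h$, for which there is a direct sum decomposition $\mathfrak h=\mathfrak g\oplus\mathfrak m$ with $\mathfrak m$ a vector subspace satisfying $\mathrm{Ad}_a(\mathfrak m)\subset\mathfrak m$ for all $a\in G$; such an $\mathfrak m$ is fixed. A reductive $G$-structure on a principal bundle $Q(M,H)$ (base $M$, structure group $H$ acting on the right) is a principal subbundle $P(M,G)$ of $Q(M,H)$ over the same base such that $G$ is a reductive Lie subgroup of $H$. $i_P^{*}(TQ)=P\times_Q TQ$ is the pull-back of $TQ$ to $P$. $\mathcal M(P)\to P$ is the vector subbundle of $i_P^{*}(VQ)$ ($VQ$ the vertical bundle of $Q\to M$), isomorphic to $P\times\mathfrak m$, whose fibre at $u\in P$ is $\mathcal M_u=\{\frac{d}{dt}|_{t=0}u\cdot\exp(t\mu)\mid\mu\in\mathfrak m\}$; the canonical decomposition is $T_uQ=T_uP\oplus\mathcal M_u$ for each $u\in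 P$. A vector field on a principal bundle is invariant under the structure group if it is preserved by the tangent maps of all right translations. *)

(* Defs.v *)
From HB Require Import structures.
From mathcomp Require Import all_boot all_order all_algebra.
From mathcomp Require Import all_classical all_reals all_analysis.

Set Implicit Arguments.
Unset Strict Implicit.
Unset Printing Implicit Defensive.

Import Order.TTheory GRing.Theory Num.Theory.
Import numFieldNormedType.Exports.

Local Open Scope classical_set_scope.
Local Open Scope ring_scope.

(** * Smooth (C^oo) maps between finite-dimensional normed spaces *)

Fixpoint iter_derive (R : realType) (V W : normedModType R) (vs : seq V)
    (f : V -> W) : V -> W :=
  if vs is v :: vs' then iter_derive vs' (fun x => 'D_v f x) else f.

(* [U] is meant to be open: every iterated directional derivative of [f],
   including [f] itself, is Frechet differentiable at every point of [U]. *)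
Definition smooth_on (R : realType) (V W : normedModType R) (U : set V)
    (f : V -> W) : Prop :=
  forall vs x, U x -> differentiable (iter_derive vs f) x.

(** * Charts *)

(* Only the restrictions of [cmap] to [dom] and of [cinv] to the image of [dom]
   are meaningful, see [is_chart]. *)
Record chart (T E : Type) := Chart {
  dom : set T;
  cmap : T -> E;
  cinv : E -> T }.

Definition is_chart (R : realType) (T : topologicalType) (E : normedModType R)
    (c : chart T E) : Prop :=
  [/\ open (dom c), open (cmap c @` dom c),
      forall p, dom c p -> cinv c (cmap c p) = p,
      {within dom c, continuous (cmap c)}
    & {within cmap c @` dom c, continuous (cinv c)}].

Definition id_chart (E : Type) : chart E E := Chart setT idfun idfun.

Definition prod_chart (T T' E E' : Type) (c : chart T E) (c' : chart T' E') :
    chart (T * T') (E * E') :=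
  Chart (dom c `*` dom c') (fun p => (cmap c p.1, cmap c' p.2))
        (fun x => (cinv c x.1, cinv c' x.2)).

(* Smoothness, on an open set [D], of a map between two spaces with given
   families of charts [A] and [B]. *)
Definition smooth_between (R : realType) (T T' : topologicalType)
    (E E' : normedModType R) (A : set (chart T E)) (B : set (chart T' E'))
    (D : set T) (f : T -> T') : Prop :=
  {within D, continuous f} /\
  forall c d, A c -> B d ->
    smooth_on (cmap c @` (dom c `&` D `&` f @^-1` dom d))
              (cmap d \o f \o cinv c).

(** * Smooth manifolds *)

(* [atlas] is an arbitrary smooth atlas, not necessarily the maximal one. *)
HB.mixin Record isManifold (R : realType) M of Topological M := {
  mdim : nat;
  atlas : set (chart M 'rV[R]_mdim);
  chart_at : M -> chart M 'rV[R]_mdim;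
  atlas_is_chart : forall c, atlas c -> is_chart c;
  atlas_chart_at : forall p, atlas (chart_at p);
  dom_chart_at : forall p, dom (chart_at p) p;
  atlas_compatible : forall c d, atlas c -> atlas d ->
    smooth_on (cmap c @` (dom c `&` dom d)) (cmap d \o cinv c);
  manifold_hausdorff : hausdorff_space M;
  manifold_second_countable : @second_countable M }.

#[short(type="manifoldType")]
HB.structure Definition Manifold (R : realType) :=
  { M of Topological M & isManifold R M }.

Definition charts (R : realType) (M : manifoldType R) :
  set (chart M 'rV[R]_(@mdim R M)) := atlas.

Definition charts_at (R : realType) (M : manifoldType R) (p : M) :
  set (chart M 'rV[R]_(@mdim R M)) := [set c | charts c /\ dom c p].

Definition smooth (R : realType) (M N : manifoldType R) (D : set M)
    (f : M -> N) : Prop :=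
  smooth_between (@charts R M) (@charts R N) D f.

(* Smoothness on an open subset of the product manifold [M * N]. *)
Definition smooth2 (R : realType) (M N K : manifoldType R) (D : set (M * N))
    (f : M * N -> K) : Prop :=
  smooth_between
    [set e | exists c d, [/\ charts c, charts d & e = prod_chart c d]]
    (@charts R K) D f.

Definition smooth_curve (R : realType) (M : manifoldType R) (g : R -> M) :=
  smooth_between (E := R^o) [set @id_chart R] (@charts R M) setT g.

(** * Tangent vectors *)

(* A tangent vector at [p] is the family of its components in all the charts
   around [p], transforming by the Jacobians of the transition maps; it is
   extended by 0 to the other charts, so that all the tangent spaces of [M] are
   subspaces of the single ambient space [tvec M]. *)
Definition tvec (R : realType) (M : manifoldType R) : lmodType R :=
  chart M 'rV[R]_(@mdim R M) -> 'rV[R]_(@mdim R M).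

Definition tangent (R : realType) (M : manifoldType R) (p : M) : set (tvec M) :=
  [set v : tvec M |
    (forall c d, charts_at p c -> charts_at p d ->
       v d = 'd (cmap d \o cinv c) (cmap c p) (v c)) /\
    (forall c, ~ charts_at p c -> v c = 0)].

(* The tangent map T_p f : T_p M -> T_(f p) N. *)
Definition tmap (R : realType) (M N : manifoldType R) (f : M -> N) (p : M)
    (v : tvec M) : tvec N :=
  fun d => if `[< charts_at (f p) d >] then
      'd (cmap d \o f \o cinv (chart_at p)) (cmap (chart_at p) p)
         (v (chart_at p))
    else 0.

Definition velocity (R : realType) (M : manifoldType R) (g : R -> M) (t : R) :
    tvec M :=
  fun d => if `[< charts_at (g t) d >] then
      derive1 (cmap d \o g : R -> 'rV[R]_(@mdim R M)) t
    else 0.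

Definition injective_immersion (R : realType) (M N : manifoldType R)
    (f : M -> N) : Prop :=
  [/\ smooth setT f, injective f &
      forall p v, tangent p v -> tmap f p v = 0 -> v = 0].

(* Smooth vector fields along [f], i.e. sections of the pull-back f^*(TN). *)
Definition vector_field_along (R : realType) (M N : manifoldType R)
    (f : M -> N) (X : M -> tvec N) : Prop :=
  (forall p, tangent (f p) (X p)) /\
  forall c d, charts c -> charts d ->
    smooth_on (cmap c @` (dom c `&` f @^-1` dom d)) (fun x => X (cinv c x) d).

Definition vector_field (R : realType) (M : manifoldType R) (X : M -> tvec M) :=
  vector_field_along idfun X.

Definition linear_subspace (R : realType) (V : lmodType R) (A : set V) : Prop :=
  submod_closed [in A].

(* [C] is the internal direct sum of the subspaces [A] and [B]. *)
Definition direct_sum (R : realType) (V : lmodType R) (C A B : set V) : Prop :=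
  [/\ linear_subspace A, linear_subspace B, C = [set a + b | a in A & b in B]
    & A `&` B = [set 0]].

(** * Lie groups *)

HB.mixin Record isLieGroup (R : realType) G of Manifold R G & Group G := {
  smooth_mulg : @smooth2 R G G G setT (fun p => (p.1 * p.2)%g);
  smooth_invg : @smooth R G G setT (fun a => (a^-1)%g) }.

#[short(type="lieGroupType")]
HB.structure Definition LieGroup (R : realType) :=
  { G of Manifold R G & Group G & isLieGroup R G }.

(* As a vector space, the Lie algebra of [G] is the tangent space at 1. *)
Definition lie_algebra (R : realType) (G : lieGroupType R) : set (tvec G) :=
  tangent (1%g : G).

Definition Ad (R : realType) (G : lieGroupType R) (a : G) : tvec G -> tvec G :=
  tmap (fun h : G => (a * h * a^-1)%g) 1%g.

Definition one_parameter_subgroup (R : realType) (G : lieGroupType R)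
    (mu : tvec G) (g : R -> G) : Prop :=
  [/\ smooth_curve g, forall s t, g (s + t) = (g s * g t)%g
    & velocity g 0 = mu].

(* exp mu is the value at time 1 of the unique one-parameter subgroup with
   initial velocity [mu]. *)
Definition lie_exp (R : realType) (G : lieGroupType R) (mu : tvec G) : G :=
  xget (fun=> 1%g) (one_parameter_subgroup mu) 1.

(* Lie subgroups are immersed subgroups, given by their inclusion [j]. *)
Definition lie_subgroup (R : realType) (G H : lieGroupType R) (j : G -> H) :=
  {morph j : a b / (a * b)%g} /\ injective_immersion j.

(* The Lie algebra of the Lie subgroup [j], as a subspace of that of [H]. *)
Definition lie_subalgebra (R : realType) (G H : lieGroupType R) (j : G -> H) :
  set (tvec H) := tmap j 1%g @` @lie_algebra R G.

Definition reductive_complement (R : realType) (G H : lieGroupType R)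
    (j : G -> H) (m : set (tvec H)) : Prop :=
  direct_sum (@lie_algebra R H) (lie_subalgebra j) m /\
  forall a, Ad (j a) @` m `<=` m.

(** * Principal bundles *)

(* [(proj, k)] and [s] are mutually inverse diffeomorphisms between
   proj^-1(U) and U * H; freeness of the action and its transitivity on the
   fibres of [proj] follow from local triviality. *)
Record principal_bundle (R : realType) (M Q : manifoldType R)
    (H : lieGroupType R) := PrincipalBundle {
  proj : Q -> M;
  act : Q -> H -> Q;
  smooth_proj : smooth setT proj;
  smooth_act : smooth2 setT (fun p : Q * H => act p.1 p.2);
  act1 : forall q, act q 1%g = q;
  actM : forall q a b, act q (a * b)%g = act (act q a) b;
  proj_act : forall q a, proj (act q a) = proj q;
  locally_trivial : forall x : M,
    exists (U : set M) (k : Q -> H) (s : M * H -> Q),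
      [/\ open U /\ U x,
          smooth (proj @^-1` U) k /\ smooth2 (U `*` setT) s,
          forall q a, U (proj q) -> k (act q a) = (k q * a)%g,
          forall q, U (proj q) -> s (proj q, k q) = q
        & forall y h, U y -> proj (s (y, h)) = y /\ k (s (y, h)) = h] }.

Definition invariant_field (R : realType) (M Q : manifoldType R)
    (H : lieGroupType R) (b : principal_bundle M Q H) (X : Q -> tvec Q) :=
  forall (a : H) (q : Q), tmap (fun r => act b r a) q (X q) = X (act b q a).

(* [i : P -> Q] embeds the principal bundle [bP] with group [G] in [bQ], over
   the identity of the base, along the inclusion [j] of [G] in [H]. *)
Definition principal_subbundle (R : realType) (M P Q : manifoldType R)
    (G H : lieGroupType R) (bP : principal_bundle M P G)
    (bQ : principal_bundle M Q H) (j : G -> H) (i : P -> Q) : Prop :=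
  [/\ injective_immersion i,
      forall u a, i (act bP u a) = act bQ (i u) (j a)
    & forall u, proj bQ (i u) = proj bP u].

(* A reductive G-structure on [bQ], with the chosen complement [m]. *)
Definition reductive_structure (R : realType) (M P Q : manifoldType R)
    (G H : lieGroupType R) (bP : principal_bundle M P G)
    (bQ : principal_bundle M Q H) (j : G -> H) (i : P -> Q)
    (m : set (tvec H)) : Prop :=
  [/\ lie_subgroup j, principal_subbundle bP bQ j i
    & reductive_complement j m].

(* The fibre at [u] of the vector bundle M(P), as a subspace of T_(i u) Q. *)
Definition transverse_fibre (R : realType) (M P Q : manifoldType R)
    (H : lieGroupType R) (bQ : principal_bundle M Q H) (i : P -> Q)
    (m : set (tvec H)) (u : P) : set (tvec Q) :=
  [set velocity (fun t : R => act bQ (i u) (lie_exp (t *: mu))) 0 | mu in m].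

(* A section of M(P), regarded as a section of the ambient bundle i^*(TQ). *)
Definition transverse_field (R : realType) (M P Q : manifoldType R)
    (H : lieGroupType R) (bQ : principal_bundle M Q H) (i : P -> Q)
    (m : set (tvec H)) (X : P -> tvec Q) : Prop :=
  vector_field_along i X /\ forall u, transverse_fibre bQ i m u (X u).

(* T_(i u) Q = T_u P (+) M_u *)
Definition canonical_decomposition (R : realType) (M P Q : manifoldType R)
    (H : lieGroupType R) (bQ : principal_bundle M Q H) (i : P -> Q)
    (m : set (tvec H)) (u : P) : Prop :=
  direct_sum (tangent (i u)) (tmap i u @` tangent u)
             (transverse_fibre bQ i m u).

(* Main.v *)
(* A vector w at i u is lifted horizontally to P through T proj: the difference of
   w and of this lift is vertical, hence of the form T(orbit map)(eta) for some
   eta in h.  Splitting eta along h = g (+) m gives the decomposition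
   T_(i u) Q = T_u P (+) M_u, and in local trivializations all the ingredients of
   this construction are smooth, so that the two components of Xi o i are smooth.
   Since Ad_(j a) preserves m, right translation by j a maps M_u to M_(ua); by
   uniqueness of the decomposition, the tangent component is then G-invariant.

   As M_u is given by velocities of exponential curves, one-parameter subgroups
   have to be constructed: the integral curve of a left invariant field, obtained
   by Picard iteration in a chart, is a local homomorphism, which extends to R
   by g t = g (t / 2^n) ^ (2^n). *)

(* [lie_exp] is an [xget] with a constant default curve, so [transverse_fibre] carries no
   information until every vector of the Lie algebra is known to have exactly one one-parameter
   subgroup. Once this is proved, the fibre becomes the image of [m] under the differential of an
   orbit map, and exponentials leave the argument.

   The construction of the two components is local: lifting uses a trivialization of [P], and
   reading off the vertical remainder uses one of [Q]. The components are therefore chosen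
   pointwise; near each point the local formula gives another decomposition, and uniqueness
   transfers its smoothness to the chosen components. Lifting inside [P] makes the lift tangent to
   [P] whatever the trivializations are.

   Tangent vectors lie in one ambient space per manifold and [tmap] reads them in a chart chosen at
   the base point. Its chain rule and chart independence are proved for tangent vectors and for maps
   smooth at the point, whence the pointwise predicates [smooth_at], [smooth1_at] and [field_at]
   used throughout. *)
Require Import Defs.
From HB Require Import structures.
From mathcomp Require Import all_boot all_order all_algebra.
From mathcomp Require Import all_classical all_reals all_analysis.
From mathcomp Require Import ring lra.

Set Implicit Arguments.
Unset Strict Implicit.
Unset Printing Implicit Defensive.

Import Order.TTheory GRing.Theory Num.Theory.
Import numFieldNormedType.Exports.

Local Open Scope classical_set_scope.
Local Open Scope ring_scope.

(** * Smooth maps between normed spaces *)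

Section NearDifferentiable.
Context {R : realType} {V W : normedModType R}.

(** Local expressions of maps agree only near a point, where the charts are defined, so
    differentials have to be transported along such equalities. The first order expansion of [f] is
    one of [g], and uniqueness of the differential does the rest. *)
Lemma near_eq_is_diff (f g : V -> W) x :
  (\forall y \near x, f y = g y) -> differentiable f x ->
  differentiable g x /\ 'd g x = 'd f x :> (V -> W).
Proof.
move=> fg df.
have dg : g \o shift x = cst (g x) + 'd f x +o_ 0 id.
  apply/eqaddoP => e e0.
  move/diff_locally: df => /eqaddoP /(_ e e0) df.
  move: fg; rewrite (near_shift 0) subr0 => fg.
  near=> y; suff -> : (g \o shift x - (cst (g x) + 'd f x)) y =
      (f \o shift x - (cst (f x) + 'd f x)) y by near: y.
  have gx : f x = g x.
    by have /= := nbhs_singleton fg; rewrite add0r.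
  have gy : f (y + x) = g (y + x) by near: y.
  by rewrite ![(_ - _) y]/(_ - _) /= gx gy.
have dE : 'd g x = 'd f x :> (V -> W).
  by apply: diff_unique => //; exact: diff_continuous.
split=> //; apply/diff_locallyP; rewrite dE; split=> //.
exact: diff_continuous.
Unshelve. all: by end_near. Qed.

Lemma near_eq_differentiable (f g : V -> W) x :
  (\forall y \near x, f y = g y) -> differentiable f x -> differentiable g x.
Proof. by move=> fg df; have [] := near_eq_is_diff fg df. Qed.

Lemma near_eq_diff (f g : V -> W) x :
  (\forall y \near x, f y = g y) -> differentiable f x ->
  'd g x = 'd f x :> (V -> W).
Proof. by move=> fg df; have [] := near_eq_is_diff fg df. Qed.

(** Scaling is a continuous bilinear map on [R^o * W], so the Leibniz rule is the differential of a
    bilinear map composed with a pairing. *)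
Lemma diffZ_fun (k : V -> R^o) (f : V -> W) x :
  differentiable k x -> differentiable f x ->
  differentiable (fun y => k y *: f y) x /\
  forall v, 'd (fun y => k y *: f y) x v = 'd k x v *: f x + k x *: 'd f x v.
Proof.
move=> dk df.
pose sc := fun (a : R^o) (w : W) => a *: w.
have scl : bilinear_for
    (GRing.Scale.Law.clone _ _ *:%R _) (GRing.Scale.Law.clone _ _ *:%R _) sc.
  split=> [u'|u] a y z; rewrite /sc /=.
  - by rewrite scalerDl scalerA.
  - by rewrite scalerDr !scalerA mulrC.
pose scM := bilinear_isBilinear.Build R R^o W W _ _ sc scl.
pose scB : {bilinear R^o -> W -> W} := HB.pack sc scM.
have scc : continuous (fun p : R^o * W => scB p.1 p.2).
  by move=> p; apply: continuousZ => ?; [exact: cvg_fst|exact: cvg_snd].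
have dp := differentiable_pair dk df.
have ds := differentiable_bilin (k x, f x) scc.
split; first exact: (differentiable_comp dp ds).
move=> v; have -> : (fun y => k y *: f y) =
  (fun p : R^o * W => scB p.1 p.2) \o (fun y => (k y, f y)) by [].
rewrite (congr1 (@^~ v) (diff_comp dp ds)) /=.
rewrite (congr1 (@^~ _) (diff_bilin (k x, f x) scc)) /=.
by rewrite (congr1 (@^~ v) (diff_pair dk df)) /= /sc addrC.
Qed.

End NearDifferentiable.

Section DiffEq.
Context {R : realType} {U V W : normedModType R}.

Lemma diff_compE (f : U -> V) (g : V -> W) x v :
  differentiable f x -> differentiable g (f x) ->
  'd (g \o f) x v = 'd g (f x) ('d f x v).
Proof. by move=> df dg; rewrite (congr1 (@^~ v) (diff_comp df dg)). Qed.

Lemma diff_linE (f : {linear U -> V}) x v : continuous f -> 'd f x v = f v.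
Proof. by move=> cf; rewrite (congr1 (@^~ v) (diff_lin x cf)). Qed.

Lemma diff_pairE (f : U -> V) (g : U -> W) x v :
  differentiable f x -> differentiable g x ->
  'd (fun y => (f y, g y)) x v = ('d f x v, 'd g x v).
Proof. by move=> df dg; rewrite (congr1 (@^~ v) (diff_pair df dg)). Qed.

Lemma diff_idE x (v : U) : 'd (@idfun U) x v = v.
Proof. by rewrite (@diff_val _ _ _ _ _ _ _ (is_diff_id x)). Qed.

Lemma differentiable_id x : differentiable (@idfun U) x.
Proof. exact: (@ex_diff _ _ _ _ _ _ _ (is_diff_id x)). Qed.

End DiffEq.

Section SmoothAt.
Context {R : realType}.
Implicit Types V W Z : normedModType R.

(** The order is made explicit because the Leibniz and chain rules reintroduce the functions
    themselves next to their derivatives: closure properties are proved by induction on [n], not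
    along a list of directions. *)
Fixpoint Ck V W (n : nat) (U : set V) (f : V -> W) : Prop :=
  if n is n'.+1 then
    (forall x, U x -> differentiable f x) /\ forall v, Ck n' U ('D_v f)
  else True.

Lemma smooth_onP V W (U : set V) (f : V -> W) :
  smooth_on U f <-> forall n, Ck n U f.
Proof.
split=> [sf n|Cf vs].
  elim: n f sf => [//|n IH] f sf; split=> [x Ux|v]; first exact: (sf [::]).
  by apply: IH => vs; exact: (sf (v :: vs)).
elim: vs f Cf => [|v vs IH] f Cf x Ux; first exact: (Cf 1%N).1.
by apply: IH => // n; exact: (Cf n.+1).2.
Qed.

Lemma Ck_ext V W n (U : set V) (f g : V -> W) :
  open U -> {in U, f =1 g} -> Ck n U f -> Ck n U g.
Proof.
move=> oU; elim: n f g => [//|n IH] f g fg [df Df].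
have nfg x : U x -> \forall y \near x, f y = g y.
  move=> Ux; apply: filterS (open_nbhs_nbhs (conj oU Ux)) => y Uy.
  by apply: fg; rewrite inE.
split=> [x Ux|v]; first exact: near_eq_differentiable (nfg x Ux) (df x Ux).
by apply: (IH _ _ _ (Df v)) => x /[!inE] Ux; exact/near_eq_derive/nfg.
Qed.

Lemma Ck_le V W n (U : set V) (f : V -> W) : Ck n.+1 U f -> Ck n U f.
Proof.
elim: n f => [//|n IH] f [df Df]; split=> // v; exact: IH.
Qed.

Lemma Ck_cst V W n (U : set V) (a : W) : Ck n U (cst a).
Proof.
elim: n a => [//|n IH] a; split=> [x _|v]; first exact: differentiable_cst.
suff -> : 'D_v (cst a) = cst (0 : W) :> (V -> W) by exact: IH.
by apply/funext => x; rewrite derive_cst.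
Qed.

Lemma Ck_linear_comp V W Z n (U : set V) (l : {linear W -> Z}) (f : V -> W) :
  open U -> continuous l -> Ck n U f -> Ck n U (l \o f).
Proof.
move=> oU cl; elim: n f => [//|n IH] f [df Df].
have dl x : differentiable l x by exact: linear_differentiable.
split=> [x Ux|v]; first by apply: differentiable_comp; [exact: df|].
apply: Ck_ext (IH _ (Df v)) => // x /[!inE] Ux /=.
have [dfx dlx] := (df x Ux, dl (f x)).
rewrite (deriveE _ dfx) (deriveE _ (differentiable_comp dfx dlx)).
by rewrite (diff_compE _ dfx dlx) (diff_linE _ _ cl).
Qed.

Lemma Ck_id V n (U : set V) : Ck n U (@idfun V).
Proof.
case: n => [//|n]; split=> [x _|v]; first exact: differentiable_id.
suff -> : 'D_v (@idfun V) = cst v :> (V -> V) by exact: Ck_cst.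
by apply/funext => x; rewrite deriveE ?diff_idE//; exact: differentiable_id.
Qed.

Lemma CkD V W n (U : set V) (f g : V -> W) :
  open U -> Ck n U f -> Ck n U g -> Ck n U (f + g).
Proof.
move=> oU; elim: n f g => [//|n IH] f g [df Df] [dg Dg].
split=> [x Ux|v]; first by apply: differentiableD; [exact: df|exact: dg].
apply: Ck_ext (IH _ _ (Df v) (Dg v)) => // x /[!inE] Ux.
by rewrite deriveD //; apply: diff_derivable; [exact: df|exact: dg].
Qed.

Lemma Ck_sum V W n k (U : set V) (f : 'I_k -> V -> W) :
  open U -> (forall i, Ck n U (f i)) -> Ck n U (\sum_i f i).
Proof.
move=> oU Cf; elim/big_ind : _ => [|g h Cg Ch|i _]; last exact: Cf.
  exact: Ck_cst.
exact: CkD.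
Qed.

Lemma CkZ V W n (U : set V) (k : V -> R^o) (f : V -> W) :
  open U -> Ck n U k -> Ck n U f -> Ck n U (fun x => k x *: f x).
Proof.
move=> oU; elim: n k f => [//|n IH] k f Ck1 Cf1.
have [dk Dk] := Ck1; have [df Df] := Cf1.
split=> [x Ux|v]; first exact: (diffZ_fun (dk x Ux) (df x Ux)).1.
apply: Ck_ext (CkD oU (IH _ _ (Dk v) (Ck_le Cf1)) (IH _ _ (Ck_le Ck1) (Df v))).
  exact: oU.
move=> x /[!inE] Ux; have [dkf dkfE] := diffZ_fun (dk x Ux) (df x Ux).
rewrite (deriveE _ dkf) dkfE -[LHS]/(_ + _) (deriveE _ (dk x Ux)).
by rewrite (deriveE _ (df x Ux)).
Qed.

Lemma Ck_pair V W Z n (U : set V) (f : V -> W) (g : V -> Z) :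
  open U -> Ck n U f -> Ck n U g -> Ck n U (fun x => (f x, g x)).
Proof.
move=> oU; elim: n f g => [//|n IH] f g [df Df] [dg Dg].
split=> [x Ux|v]; first by apply: differentiable_pair; [exact: df|exact: dg].
apply: Ck_ext (IH _ _ (Df v) (Dg v)) => // x /[!inE] Ux.
have [dfx dgx] := (df x Ux, dg x Ux).
rewrite (deriveE _ dfx) (deriveE _ dgx) deriveE ?diff_pair//.
exact: differentiable_pair.
Qed.

(** [Ck] differentiates in constant directions, whereas the chain rule differentiates the outer map
    in a direction that moves with the point. Finitely many continuous coordinates resolve the
    moving direction into constant ones. *)
Definition finite_dim W :=
  exists k (e : 'I_k -> W) (l : 'I_k -> {linear W -> R^o}),
  (forall i, continuous (l i)) /\ forall w, w = \sum_i l i w *: e i.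
Existing Class finite_dim.

(* 'D_v (g \o f) is the sum of the l_i ('D_v f) *: ('D_(e_i) g \o f), where
   (e_i) is a basis of the intermediate space and (l_i) the dual basis. *)
Lemma Ck_comp V W Z n (U : set V) (U' : set W) (g : W -> Z) (f : V -> W) :
  finite_dim W -> open U -> open U' -> (forall x, U x -> U' (f x)) ->
  Ck n U' g -> Ck n U f -> Ck n U (g \o f).
Proof.
move=> [k [e [l [cl le]]]] oU oU'; elim: n g f => [//|n IH] g f UU' Cg Cf.
have [dg Dg] := Cg; have [df Df] := Cf.
split=> [x Ux|v].
  by apply: differentiable_comp; [exact: df|exact/dg/UU'].
pose h i := fun x => (l i \o 'D_v f) x *: ('D_(e i) g \o f) x.
have Ch : Ck n U (\sum_i h i).
  apply: Ck_sum => // i; apply: (CkZ oU); first exact: Ck_linear_comp (Df v).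
  exact: (IH _ _ UU' (Dg _) (Ck_le Cf)).
apply: Ck_ext Ch => // x /[!inE] Ux.
have [dfx dgx] := (df x Ux, dg _ (UU' x Ux)).
rewrite (deriveE _ (differentiable_comp dfx dgx)) diff_compE // -(deriveE _ dfx).
rewrite (le ('D_v f x)) linear_sum fct_sumE; apply: eq_bigr => i _.
by rewrite linearZ -deriveE.
Qed.

(** This is the local form of a tangent map applied to a vector field along [f]. The differential
    costs one order of [g], hence the [n.+1]. *)
Lemma Ck_diff V W Z n (U : set V) (U' : set W) (g : W -> Z) (f w : V -> W) :
  finite_dim W -> open U -> open U' -> (forall x, U x -> U' (f x)) ->
  Ck n.+1 U' g -> Ck n U f -> Ck n U w -> Ck n U (fun x => 'd g (f x) (w x)).
Proof.
move=> fW oU oU' UU' [dg Dg] Cf Cw; have [k [e [l [cl le]]]] := fW.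
pose h i := fun x => (l i \o w) x *: ('D_(e i) g \o f) x.
have Ch : Ck n U (\sum_i h i).
  apply: Ck_sum => // i; apply: (CkZ oU); first exact: Ck_linear_comp Cw.
  exact: (Ck_comp fW oU oU' UU' (Dg _) Cf).
apply: Ck_ext Ch => // x /[!inE] Ux.
rewrite [in RHS](le (w x)) linear_sum fct_sumE; apply: eq_bigr => i _.
by rewrite linearZ -deriveE //; exact/dg/UU'.
Qed.

Lemma finite_dim_prod V W : finite_dim V -> finite_dim W ->
  finite_dim (V * W)%type.
Proof.
move=> [k [e [l [cl le]]]] [k' [e' [l' [cl' le']]]].
pose E (i : 'I_(k + k')) : V * W := match fintype.split i with
  | inl j => (e j, 0) | inr j => (0, e' j) end.
pose fstL : {linear (V * W)%type -> V} := fst.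
pose sndL : {linear (V * W)%type -> W} := snd.
pose L (i : 'I_(k + k')) : {linear (V * W)%type -> R^o} :=
  match fintype.split i with
  | inl j => l j \o fstL | inr j => l' j \o sndL end.
exists (k + k')%N, E, L; split=> [i|[v w]].
  rewrite /L; case: fintype.splitP => j _ /= x.
    by apply: (@continuous_comp _ _ _ fst (l j)); [exact: cvg_fst|exact: cl].
  by apply: (@continuous_comp _ _ _ snd (l' j)); [exact: cvg_snd|exact: cl'].
rewrite big_split_ord /= /L /E.
under eq_bigr do rewrite (unsplitK (inl _)) /=.
under [X in _ + X]eq_bigr do rewrite (unsplitK (inr _)) /=.
rewrite [RHS]surjective_pairing; congr (_, _); rewrite raddfD /= !raddf_sum /=.
  by rewrite [X in _ + X]big1 ?addr0 => [|i _]; rewrite ?scaler0 // -le.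
by rewrite [X in X + _]big1 ?add0r => [|i _]; rewrite ?scaler0 // -le'.
Qed.

Lemma finite_dim_rV n : finite_dim 'rV[R]_n.
Proof.
pose l (i : 'I_n) (x : 'rV[R]_n) : R^o := x ord0 i.
have ll i : linear (l i) by move=> a x y; rewrite /l !mxE.
pose lM i := GRing.isLinear.Build _ _ _ _ _ (ll i).
pose lL i : {linear 'rV[R]_n -> R^o} := HB.pack (l i) (lM i).
exists n, (fun i => delta_mx ord0 i), lL; split=> [i|w].
  exact: coord_continuous.
exact: row_sum_delta.
Qed.

Lemma finite_dim_regular : finite_dim R^o.
Proof.
exists 1%N, (fun=> 1), (fun=> @idfun R^o); split=> [_ x //|w].
by rewrite big_ord1 /= /GRing.scale /= mulr1.
Qed.

End SmoothAt.

#[export] Existing Instance finite_dim_prod.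
#[export] Existing Instance finite_dim_rV.
#[export] Existing Instance finite_dim_regular.

(** * Smoothness near a point *)

Section SmoothAtTheory.
Context {R : realType}.
Implicit Types V W Z : normedModType R.

(** A neighbourhood is built in because the rules for [Ck] hold on open sets: the points where [f]
    is smooth in this sense form an open set, so no domain has to be carried along. *)
Definition smooth_at V W (f : V -> W) (x : V) : Prop :=
  \forall y \near x, smooth_on [set y] f.

Lemma smooth_onE V W (U : set V) (f : V -> W) :
  smooth_on U f <-> forall x, U x -> smooth_on [set x] f.
Proof.
split=> [sf x Ux vs y ->|sf vs x Ux]; first exact: sf.
exact: (sf x Ux vs x).
Qed.

Lemma smooth_on_smooth_at V W (U : set V) (f : V -> W) x :
  open U -> U x -> smooth_on U f -> smooth_at f x.
Proof.
move=> oU Ux /smooth_onE sf; apply: (filterS sf).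
exact: (open_nbhs_nbhs (conj oU Ux)).
Qed.

Lemma smooth_at_smooth_on V W (U : set V) (f : V -> W) :
  (forall x, U x -> smooth_at f x) -> smooth_on U f.
Proof.
move=> sf; apply/smooth_onE => x /sf; exact: nbhs_singleton.
Qed.

Lemma near_smooth_at V W (f : V -> W) x :
  smooth_at f x -> \forall y \near x, smooth_at f y.
Proof. exact: nbhs_interior. Qed.

Lemma smooth_at_differentiable V W (f : V -> W) x :
  smooth_at f x -> differentiable f x.
Proof. by move=> /nbhs_singleton sf; exact: (sf [::]). Qed.

Lemma smooth_at_continuous V W (f : V -> W) x :
  smooth_at f x -> {for x, continuous f}.
Proof. by move=> /smooth_at_differentiable/differentiable_continuous. Qed.

Lemma open_smooth_at V W (f : V -> W) : open [set x | smooth_at f x].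
Proof. by rewrite openE => x /near_smooth_at. Qed.

Lemma smooth_at_Ck V W (f : V -> W) x :
  (exists U, [/\ open U, U x & forall n, Ck n U f]) <-> smooth_at f x.
Proof.
split=> [[U [oU Ux Cf]]|sf].
  by apply: (smooth_on_smooth_at oU Ux); apply/smooth_onP.
exists [set x | smooth_at f x]; split=> //; first exact: open_smooth_at.
exact/smooth_onP/smooth_at_smooth_on.
Qed.

Lemma Ck_smooth_at V W n U (f : V -> W) :
  U `<=` [set x | smooth_at f x] -> Ck n U f.
Proof.
by move=> /smooth_at_smooth_on/smooth_onP.
Qed.

Lemma smooth_at_near_eq V W (f g : V -> W) x :
  (\forall y \near x, f y = g y) -> smooth_at f x -> smooth_at g x.
Proof.
move=> fg sf; apply/smooth_at_Ck.
pose U := [set x | smooth_at f x] `&` [set y | f y = g y]^°.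
have oU : open U by apply: openI; [exact: open_smooth_at|exact: open_interior].
exists U; split=> // n.
have Cf : Ck n U f by apply: Ck_smooth_at => y [].
by apply: (Ck_ext oU) Cf => y /[!inE] -[_ /nbhs_singleton].
Qed.

Lemma smooth_at_linear_comp V W Z (l : {linear W -> Z}) (f : V -> W) x :
  continuous l -> smooth_at f x -> smooth_at (l \o f) x.
Proof.
move=> cl /smooth_at_Ck[U [oU Ux Cf]]; apply/smooth_at_Ck; exists U; split=> //.
by move=> n; exact: Ck_linear_comp.
Qed.

Lemma smooth_at_derive V W (f : V -> W) v x :
  smooth_at f x -> smooth_at ('D_v f) x.
Proof.
by apply: filterS => y sf vs; exact: (sf (v :: vs)).
Qed.

Lemma smooth_at_cst V W (a : W) (x : V) : smooth_at (fun=> a) x.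
Proof.
by apply/smooth_at_Ck; exists setT; split=> // [|n]; [exact: openT|exact: Ck_cst].
Qed.

Lemma smooth_at_id V (x : V) : smooth_at (fun y => y) x.
Proof.
by apply/smooth_at_Ck; exists setT; split=> // [|n]; [exact: openT|exact: Ck_id].
Qed.

Lemma smooth_at_linear V W (l : {linear V -> W}) x :
  continuous l -> smooth_at l x.
Proof. by move=> cl; exact: smooth_at_linear_comp (smooth_at_id x). Qed.

Lemma smooth_atD V W (f g : V -> W) x :
  smooth_at f x -> smooth_at g x -> smooth_at (fun y => f y + g y) x.
Proof.
move=> sf sg; apply/smooth_at_Ck.
exists ([set x | smooth_at f x] `&` [set x | smooth_at g x]).
have oU := openI (open_smooth_at f) (open_smooth_at g).
by split=> // n; apply: (CkD oU); apply: Ck_smooth_at => y [].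
Qed.

Lemma smooth_atZ V W (k : V -> R^o) (f : V -> W) x :
  smooth_at k x -> smooth_at f x -> smooth_at (fun y => k y *: f y) x.
Proof.
move=> sk sf; apply/smooth_at_Ck.
exists ([set x | smooth_at k x] `&` [set x | smooth_at f x]).
have oU := openI (open_smooth_at k) (open_smooth_at f).
by split=> // n; apply: (CkZ oU); apply: Ck_smooth_at => y [].
Qed.

Lemma smooth_at_pair V W Z (f : V -> W) (g : V -> Z) x :
  smooth_at f x -> smooth_at g x -> smooth_at (fun y => (f y, g y)) x.
Proof.
move=> sf sg; apply/smooth_at_Ck.
exists ([set x | smooth_at f x] `&` [set x | smooth_at g x]).
have oU := openI (open_smooth_at f) (open_smooth_at g).
by split=> // n; apply: (Ck_pair oU); apply: Ck_smooth_at => y [].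
Qed.

Lemma open_smooth_at_comp V W Z (g : W -> Z) (f : V -> W) :
  open [set x | smooth_at f x /\ smooth_at g (f x)].
Proof.
rewrite openE => x [sf sg]; rewrite /interior /=; near=> y; split; near: y.
  exact: near_smooth_at.
exact: (smooth_at_continuous sf) (near_smooth_at sg).
Unshelve. all: by end_near. Qed.

Lemma smooth_at_comp V W Z {fW : finite_dim W} (g : W -> Z) (f : V -> W) x :
  smooth_at g (f x) -> smooth_at f x -> smooth_at (g \o f) x.
Proof.
move=> sg sf; apply/smooth_at_Ck.
exists [set x | smooth_at f x /\ smooth_at g (f x)].
have oU := open_smooth_at_comp g f.
split=> // n; apply: (Ck_comp fW oU (open_smooth_at g)) => [y []//||].
  exact: Ck_smooth_at.
by apply: Ck_smooth_at => y [].
Qed.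

Lemma smooth_at_diff V W Z {fW : finite_dim W} (g : W -> Z) (f w : V -> W) x :
  smooth_at g (f x) -> smooth_at f x -> smooth_at w x ->
  smooth_at (fun y => 'd g (f y) (w y)) x.
Proof.
move=> sg sf sw; apply/smooth_at_Ck.
pose U := [set x | smooth_at f x /\ smooth_at g (f x)].
exists (U `&` [set x | smooth_at w x]).
have oU := openI (open_smooth_at_comp g f)
  (open_smooth_at w).
split=> // n; apply: (Ck_diff fW oU (open_smooth_at g)).
- by move=> y [[]].
- exact: Ck_smooth_at.
- by apply: Ck_smooth_at => y [[]].
- by apply: Ck_smooth_at => y [].
Qed.

End SmoothAtTheory.

(** * Ordinary differential equations *)

Section VectorCurves.
Context {R : realType} {n : nat}.
Implicit Types (f : R -> 'rV[R]_n) (x y : 'rV[R]_n) (t : R).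

Lemma rV_norm_le x (K : R) :
  0 <= K -> (forall k, `|x ord0 k| <= K) -> `|x| <= K.
Proof.
move=> K0 xK; rewrite /Num.Def.normr /= mx_normrE.
by apply: bigmax_le => // -[i k] _ /=; rewrite ord1.
Qed.

Lemma rV_coord_le x k : `|x ord0 k| <= `|x|.
Proof.
rewrite [leRHS]/Num.Def.normr /= mx_normrE.
exact: (le_bigmax _ (fun ij : 'I_1 * 'I_n => `|x ij.1 ij.2|) (ord0, k)).
Qed.

Lemma is_derive_coord f t v k :
  is_derive t 1 f v -> is_derive t 1 (fun s => f s ord0 k) (v ord0 k).
Proof.
move=> [df <-]; apply: DeriveDef; first exact: (derivable_mxP f t 1).1.
by rewrite derive_mx // mxE.
Qed.

Lemma is_derive_rV f t (v : 'rV[R]_n) :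
  (forall k, is_derive t 1 (fun s => f s ord0 k) (v ord0 k)) ->
  is_derive t 1 f v.
Proof.
move=> df; have dft : derivable f t 1.
  by apply/(derivable_mxP f t 1) => i k; rewrite ord1; have [] := df k.
apply: DeriveDef => //; apply/rowP => k.
by rewrite derive_mx // mxE; have [] := df k.
Qed.

(** The norm is the maximum of the coordinates, so the scalar mean value theorem applied to each
    coordinate gives the estimate with the same constant. *)
Lemma MVT_le f (df : R -> 'rV[R]_n) (K a b : R) :
  (forall t, t \in `[Num.min a b, Num.max a b] ->
     is_derive t 1 f (df t) /\ `|df t| <= K) ->
  `|f b - f a| <= K * `|b - a|.
Proof.
wlog ab : a b / a <= b => [H dfK|].
  have [/H|/ltW ba] := leP a b; first exact.
  by rewrite distrC (distrC b); apply: H => //; rewrite minC maxC.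
rewrite (min_idPl ab) (max_idPr ab) => dfK.
have K0 : 0 <= K.
  by apply: le_trans (dfK a _).2; rewrite ?normr_ge0 // in_itv /= lexx.
apply: rV_norm_le => [|k]; first by rewrite mulr_ge0.
have dfk t : t \in `[a, b] -> is_derive t 1 (fun s => f s ord0 k) (df t ord0 k).
  by move=> /dfK[+ _] => /is_derive_coord.
have cf : {within `[a, b], continuous (fun s => f s ord0 k)}.
  apply: derivable_within_continuous => t /dfk[]; exact.
have [t tab] := MVT_segment ab
  (fun t tab => dfk t (subset_itv_oo_cc tab)) cf.
rewrite !mxE => ->; rewrite normrM ler_wpM2r //.
by apply: le_trans (rV_coord_le _ _) (dfK t tab).2.
Qed.

End VectorCurves.

Section Antiderivative.
Context {R : realType}.

Lemma antiderivative (f : R -> R) (A : R) :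
  continuous f ->
  exists F : R -> R, forall t : R, `|t| < A -> is_derive t 1 F (f t).
Proof.
(* Integrating from [- A] instead of 0 makes every [t] with [|t| < A], negative ones included,
   interior to the interval of integration. *)
move=> cf; pose F x := (\int[lebesgue_measure]_(t in `[(- A)%R, x]) f t)%R.
exists F => t; rewrite ltr_norml => /andP[At tA].
have fi : lebesgue_measure.-integrable `[(- A)%R, A] (EFin \o f).
  apply: continuous_compact_integrable; first exact: segment_compact.
  exact: continuous_subspaceT.
have [dF FE] := continuous_FTC1_closed tA fi At (cf t).
by apply: DeriveDef; [exact: dF|rewrite -FE derive1E].
Qed.

Lemma antiderivative_rV n (f : R -> 'rV[R]_n) (A : R) (e : 'rV[R]_n) :
  continuous f -> 0 < A -> exists2 F : R -> 'rV[R]_n, F 0 = e &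
    forall t : R, `|t| < A -> is_derive t 1 F (f t).
Proof.
move=> cf A0.
have /choice[F FE] k : exists F : R -> R,
    forall t : R, `|t| < A -> is_derive t 1 F (f t ord0 k).
  apply: (antiderivative (f := fun t => f t ord0 k)) => t.
  apply: (@continuous_comp _ _ _ f (fun x : 'rV[R]_n => x ord0 k)).
    exact: cf.
  exact: coord_continuous.
exists (fun t => \row_k (F k t - F k 0 + e ord0 k)).
  by apply/rowP => k; rewrite mxE subrr add0r.
move=> t tA; apply: is_derive_rV => k.
rewrite (_ : (fun s => _) = F k + cst (e ord0 k - F k 0)); last first.
  by apply/funext => s; rewrite mxE addrAC addrA.
rewrite -[f t _ _]addr0; apply: is_deriveD; exact: FE.
Qed.

End Antiderivative.

(** * Sequences with geometrically decreasing steps *)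

Section ContractingSequence.
Context {R : realType}.

(** The intervals of centre [u k] and radius [2 * K / 2 ^+ k] are nested, since the step from [u k]
    to [u k.+1] is at most half of that radius. The limit is the supremum of their left ends, and
    nestedness also gives the rate. *)
Lemma geometric_cvg_R (u : nat -> R) (K : R) :
  (forall k, `|u k.+1 - u k| <= K / 2 ^+ k) ->
  exists l, forall k, `|l - u k| <= 2 * K / 2 ^+ k.
Proof.
move=> uK; pose d k := 2 * K / 2 ^+ k.
have dS k : d k.+1 = K / 2 ^+ k.
  by rewrite /d exprS invfM mulrA [2 * K]mulrC mulfK.
have dd k : d k = d k.+1 + d k.+1.
  by rewrite dS /d -mulrA mulr_natl mulr2n.
have lo k m : u k - d k <= u (k + m)%N - d (k + m)%N.
  elim: m => [|m]; rewrite ?addn0 // addnS => /le_trans; apply.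
  have := uK (k + m)%N; rewrite -dS ler_distl (dd (k + m)%N); lra.
have hi k m : u (k + m)%N + d (k + m)%N <= u k + d k.
  elim: m => [|m]; rewrite ?addn0 // addnS; apply: le_trans.
  have := uK (k + m)%N; rewrite -dS ler_distl (dd (k + m)%N); lra.
have d0 k : 0 <= d k.
  by rewrite dd dS; have := le_trans (normr_ge0 _) (uK k); lra.
have lohi k m : u k - d k <= u m + d m.
  have := lo k m; have := hi m k; rewrite addnC; have := d0 (k + m)%N; lra.
pose A := [set u k - d k | k in setT].
have hA : has_sup A.
  split; first by exists (u 0 - d 0), 0%N.
  by exists (u 0 + d 0) => _ [k _ <-].
exists (sup A) => k; rewrite ler_distl -/(d k); apply/andP; split.
  by apply: ub_le_sup; [exact: hA.2|exists k].
by apply: ge_sup; [exact: hA.1|move=> _ [m _ <-]].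
Qed.

Lemma geometric_cvg_rV n (u : nat -> 'rV[R]_n) (K : R) :
  (forall k, `|u k.+1 - u k| <= K / 2 ^+ k) ->
  exists l, forall k, `|l - u k| <= 2 * K / 2 ^+ k.
Proof.
move=> uK; have /choice[l lE] i : exists l, forall k,
    `|l - u k ord0 i| <= 2 * K / 2 ^+ k.
  apply: geometric_cvg_R => k; apply: le_trans (uK k).
  by have := rV_coord_le (u k.+1 - u k) i; rewrite !mxE.
have d0 k : 0 <= 2 * K / 2 ^+ k.
  by rewrite -mulrA mulr_ge0 // (le_trans (normr_ge0 _) (uK k)).
exists (\row_i l i) => k; apply: rV_norm_le => // i.
by rewrite !mxE.
Qed.

Lemma geometric_small (K e : R) : 0 < e -> exists k, K / 2 ^+ k < e.
Proof.
move=> e0; have [K0|K0] := leP K 0.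
  by exists 0; rewrite expr0 divr1 (le_lt_trans K0).
have Ke : 0 <= K / e by rewrite divr_ge0 // ltW.
exists (Num.bound (K / e)); set k := Num.bound _.
rewrite ltr_pdivrMr ?exprn_gt0 // mulrC -ltr_pdivrMr //.
apply: lt_le_trans (archi_boundP Ke) _; rewrite -/k -natrX ler_nat.
exact/ltnW/ltn_expl.
Qed.

Lemma le_geometric0 (K x : R) : (forall k, x <= K / 2 ^+ k) -> x <= 0.
Proof.
move=> xK; rewrite leNgt; apply/negP => /(geometric_small K)[k].
by rewrite ltNge xK.
Qed.

End ContractingSequence.

(** For [a <= b], the nearest-point retraction of the line onto the segment. It serves twice: on the
    time variable of the Picard iterates, and on coordinates to extend a locally Lipschitz field. *)
Definition clamp {R : realType} (a b x : R) : R := Num.max a (Num.min b x).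

Section Clamp.
Context {R : realType}.

Lemma clamp_id (a b x : R) : a <= x <= b -> clamp a b x = x.
Proof. by move=> /andP[ax xb]; rewrite /clamp (min_idPr xb) (max_idPr ax). Qed.

Lemma clamp_bounds (a b x : R) : a <= b -> a <= clamp a b x <= b.
Proof.
by move=> ab; rewrite /clamp le_max lexx /= ge_max ab ge_min lexx.
Qed.

Lemma clamp_lipschitz (a b x y : R) :
  `|clamp a b x - clamp a b y| <= `|x - y|.
Proof.
have minL u v : `|Num.min b u - Num.min b v| <= `|u - v|.
  wlog uv : u v / u <= v => [H|].
    by have [/H//|/ltW vu] := leP u v; rewrite distrC (distrC u); exact: H.
  rewrite distrC [leRHS]distrC ger0_norm ?[leRHS]ger0_norm ?subr_ge0 //.
    by case: (leP b u) => ?; case: (leP b v) => ?; lra.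
  by case: (leP b u) => ?; case: (leP b v) => ?; lra.
have maxL u v : `|Num.max a u - Num.max a v| <= `|u - v|.
  wlog uv : u v / u <= v => [H|].
    by have [/H//|/ltW vu] := leP u v; rewrite distrC (distrC u); exact: H.
  rewrite distrC [leRHS]distrC ger0_norm ?[leRHS]ger0_norm ?subr_ge0 //.
    by case: (leP a u) => ?; case: (leP a v) => ?; lra.
  by case: (leP a u) => ?; case: (leP a v) => ?; lra.
exact: le_trans (maxL _ _) (minL _ _).
Qed.

Lemma lipschitz_continuous (V W : normedModType R) (f : V -> W) (L : R) :
  (forall x y, `|f x - f y| <= L * `|x - y|) -> continuous f.
Proof.
move=> fL x; apply/cvgrPdist_lt => e e0.
have L1 : 0 < `|L| + 1 by rewrite ltr_wpDl.
near=> y; apply: le_lt_trans (fL x y) _.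
apply: (@le_lt_trans _ _ ((`|L| + 1) * `|x - y|)).
  by rewrite ler_wpM2r // (le_trans (ler_norm _)) // lerDl.
rewrite mulrC -ltr_pdivlMr //; near: y.
by apply: cvgr_dist_lt; [exact: cvg_id|rewrite divr_gt0].
Unshelve. all: by end_near. Qed.

End Clamp.

(* [delta] is such that one Picard step halves the distance on
   [- delta, delta]. *)
Section Picard.
Context {R : realType} {n : nat} (F : 'rV[R]_n -> 'rV[R]_n) (L : R).
Hypothesis L0 : 0 < L.
Hypothesis FL : forall x y, `|F x - F y| <= L * `|x - y|.

Variable delta : R.
Hypothesis delta0 : 0 < delta.
Hypothesis deltaE : 2 * L * delta = 1.

Let delta_half (K : R) : L * K * delta = K / 2.
Proof.
have -> : L * K * delta = 2 * L * delta * (K / 2) by field.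
by rewrite deltaE mul1r.
Qed.

(** The contraction estimate. The curves [f1], [f2] in the right-hand sides are kept apart from
    [g1], [g2] so that it applies to successive iterates, to the limit and to two solutions
    alike. *)
Let ode_diff_le (g1 g2 f1 f2 : R -> 'rV[R]_n) (A K : R) :
  A <= delta -> g1 0 = g2 0 ->
  (forall t : R, `|t| <= A -> is_derive t 1 g1 (F (f1 t))) ->
  (forall t : R, `|t| <= A -> is_derive t 1 g2 (F (f2 t))) ->
  (forall t : R, `|t| <= A -> `|f1 t - f2 t| <= K) ->
  forall t : R, `|t| <= A -> `|g1 t - g2 t| <= K / 2.
Proof.
move=> Ad g0 d1 d2 fK t tA.
have K0 : 0 <= K by rewrite (le_trans _ (fK _ tA)).
have : `|(g1 \- g2) t - (g1 \- g2) 0| <= L * K * `|t - 0|.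
  apply: (MVT_le (df := fun s => F (f1 s) - F (f2 s))) => s s0t.
  have sA : `|s| <= A.
    apply: le_trans tA; move: s0t; rewrite in_itv /= ge_min le_max.
    by rewrite ler_norml; have [t0|t0] := ger0P t; lra.
  split; first by apply: is_deriveB; [exact: d1|exact: d2].
  by apply: le_trans (FL _ _) _; rewrite ler_pM2l // fK.
rewrite /= g0 subrr !subr0 => /le_trans; apply.
by rewrite -delta_half ler_wpM2l ?(le_trans tA) // mulr_ge0 // ltW.
Qed.

Lemma lipschitz_ode_exists (e : 'rV[R]_n) :
  exists2 g : R -> 'rV[R]_n, g 0 = e &
    forall t : R, `|t| < delta -> is_derive t 1 g (F (g t)).
Proof.
have cF : continuous F := lipschitz_continuous FL.
(* [P] integrates from time 0 with initial value [e]; its value at a discontinuous [h] is a mere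
   default. The radius [2 * delta] provides derivatives on the whole closed interval of radius
   [delta]. *)
have /choice[P PE] (h : R -> 'rV[R]_n) : exists G : R -> 'rV[R]_n,
    continuous h -> G 0 = e /\
    forall t : R, `|t| < 2 * delta -> is_derive t 1 G (h t).
  have [ch|nch] := pselect (continuous h); last by exists h.
  have [|G G0 GE] := antiderivative_rV (A := 2 * delta) e ch.
    by rewrite mulr_gt0.
  by exists G.
(* The iterates are controlled only for [|t| <= delta], while [P] wants functions continuous on the
   whole line; freezing time outside that interval reconciles the two. *)
pose c := clamp (- delta) delta.
have cb t : `|c t| <= delta.
  by rewrite ler_norml /c clamp_bounds // ge0_cp // ltW.
have cid t : `|t| <= delta -> c t = t.
  by rewrite ler_norml; exact: clamp_id.
have cc : continuous c.
  apply: (@lipschitz_continuous _ _ _ _ 1) => x y.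
  by rewrite mul1r; exact: clamp_lipschitz.
pose u := fix u k := if k is k'.+1 then P (F \o (u k' \o c)) else cst e.
have lt2 (t : R) : `|t| <= delta -> `|t| < 2 * delta.
  by move=> td; have := delta0; lra.
have cFc h : continuous (h \o c) -> continuous (F \o (h \o c)).
  by move=> ch t; apply: continuous_comp; [exact: ch|exact: cF].
have cu k : continuous (u k \o c).
  elim: k => [|k IH]; first by move=> t; exact: cvg_cst.
  move=> t; apply: continuous_comp; first exact: cc.
  have [_ /(_ _ (lt2 _ (cb t)))[+ _]] := PE _ (cFc _ IH).
  by move=> /derivable1_diffP/differentiable_continuous.
have u0 k : u k 0 = e.
  by case: k => [//|k]; have [] := PE _ (cFc _ (cu k)).
have du k (t : R) : `|t| <= delta -> is_derive t 1 (u k.+1) (F (u k t)).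
  move=> td; have [_ /(_ _ (lt2 _ td))] := PE _ (cFc _ (cu k)).
  by rewrite /= cid.
pose K := `|F e| * delta.
have K0 : 0 <= K by rewrite mulr_ge0 // ltW.
have uK k (t : R) : `|t| <= delta -> `|u k.+1 t - u k t| <= K / 2 ^+ k.
  elim: k t => [|k IH] t td; last first.
    rewrite exprSr invfM mulrA.
    by apply: (ode_diff_le _ _ (du k.+1) (du k) IH) => //; rewrite !u0.
  rewrite expr0 divr1 -[u 0%N t]/e -[X in _ - X](u0 1%N).
  apply: (@le_trans _ _ (`|F e| * `|t - 0|)); last first.
    by rewrite subr0 ler_wpM2l.
  apply: (MVT_le (df := fun=> F e)) => s s0t; split=> //; apply: (du 0%N).
  apply: le_trans td; move: s0t; rewrite in_itv /= ge_min le_max.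
  by rewrite ler_norml; have [t0|t0] := ger0P t; lra.
have /choice[g gE] t : exists l, forall k, `|l - u k (c t)| <= 2 * K / 2 ^+ k.
  by apply: geometric_cvg_rV => k; exact: uK.
have cg : continuous g.
  move=> t; apply/cvgrPdist_lt => eps eps0.
  have eps3 : 0 < eps / 3 by rewrite divr_gt0.
  have [k ke] := geometric_small (2 * K) eps3.
  near=> s.
  have H1 := gE t k; have H2 := gE s k.
  have H3 : `|u k (c t) - u k (c s)| < eps / 3.
    near: s; apply: cvgr_dist_lt => //; exact: cu.
  have := ler_distD (u k (c t)) (g t) (g s).
  have := ler_distD (u k (c s)) (u k (c t)) (g s).
  rewrite (distrC (u k (c s))); lra.
have [G0 dG] := PE (F \o g) (fun t => continuous_comp (cg t) (cF _)).
(* The limit is a fixed point of the Picard map: both sides are within [K / 2 ^+ k] of [u k.+1 t],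
   for every [k]. *)
have GE (t : R) : `|t| <= delta -> P (F \o g) t = g t.
  move=> td; apply/eqP; rewrite -subr_eq0 -normr_le0.
  apply: (@le_geometric0 _ (2 * K)) => k.
  have H1 : `|P (F \o g) t - u k.+1 t| <= (2 * K / 2 ^+ k) / 2.
    apply: (ode_diff_le _ _ _ (du k)) td => [//||s sd|s sd].
    - by rewrite G0 u0.
    - exact/dG/lt2.
    - by rewrite -{2}(cid _ sd).
  have := gE t k.+1; rewrite (cid _ td) exprSr invfM mulrA distrC => H2.
  by have := ler_distD (u k.+1 t) (P (F \o g) t) (g t); lra.
(* The witness is the integral and not [g]: its derivative is known by construction, and [g] agrees
   with it only for [|t| <= delta]. *)
exists (P (F \o g)) => // t td; rewrite GE ?(ltW td) //.
exact/dG/lt2/ltW.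
Unshelve. all: by end_near. Qed.

(** The distance of the two solutions is bounded by its maximum on a compact interval, and the
    contraction estimate halves any such bound indefinitely. *)
Lemma lipschitz_ode_unique (g1 g2 : R -> 'rV[R]_n) (A : R) :
  0 < A -> A <= delta -> g1 0 = g2 0 ->
  (forall t : R, `|t| <= A -> is_derive t 1 g1 (F (g1 t))) ->
  (forall t : R, `|t| <= A -> is_derive t 1 g2 (F (g2 t))) ->
  forall t, `|t| <= A -> g1 t = g2 t.
Proof.
move=> A0 Ad g0 d1 d2.
have cg : {within `[- A, A], continuous (fun t => `|g1 t - g2 t|)}.
  have cg0 : {within `[- A, A], continuous (fun t => g1 t - g2 t)}.
    apply: derivable_within_continuous => t; rewrite in_itv /= -ler_norml => tA.
    by apply: derivableB; [have [] := d1 t tA|have [] := d2 t tA].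
  by move=> t; apply: continuous_comp; [exact: cg0|exact: norm_continuous].
have [|c _ cmax] := EVT_max _ cg; first by lra.
set K := `|g1 c - g2 c| in cmax.
have H k (t : R) : `|t| <= A -> `|g1 t - g2 t| <= K / 2 ^+ k.
  elim: k t => [|k IH] t tA.
    by rewrite expr0 invr1 mulr1; apply: cmax; rewrite in_itv /= -ler_norml.
  by rewrite exprSr invfM mulrA; exact: (ode_diff_le Ad g0 d1 d2 IH).
move=> t tA; apply/eqP; rewrite -subr_eq0 -normr_le0.
by apply: (@le_geometric0 _ K) => k; exact: H.
Qed.

End Picard.

Lemma line_differentiable {R : realType} (V : normedModType R) (y w : V) (t : R) :
  differentiable (fun s : R => y + s *: w) t /\
  forall h, 'd (fun s : R => y + s *: w) t h = h *: w.
Proof.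
have dl := is_diff_scalel t w; have dc := is_diff_cst y t.
have [d1 d2] := (@ex_diff _ _ _ _ _ _ _ dl, @ex_diff _ _ _ _ _ _ _ dc).
split=> [|h]; first exact: (differentiableD d2 d1).
have E1 := congr1 (@^~ h) (diff_cst y t).
have E2 := congr1 (@^~ h) (@diff_val _ _ _ _ _ _ _ dl).
apply: etrans (congr1 (@^~ h) (diffD d2 d1)) _.
exact: etrans (congr2 +%R E1 E2) (add0r _).
Qed.

(** * Integral curves of smooth fields *)

Section LocalODE.
Context {R : realType} {n : nat}.

(** Near [e] the partial derivatives are bounded, and the mean value inequality applies along
    segments, which stay in the ball by convexity. Every small radius works, so that the ball can
    also be fitted into a prescribed neighbourhood. *)
Lemma smooth_at_locally_lipschitz (m : nat) (F : 'rV[R]_m -> 'rV[R]_n) e :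
  smooth_at F e -> \forall r \near 0^'+, exists2 L, 0 < L &
    forall x y, `|x - e| <= r -> `|y - e| <= r -> `|F x - F y| <= L * `|x - y|.
Proof.
move=> sF.
pose D (i : 'I_m) := 'D_(delta_mx ord0 i) F.
have nD : \forall y \near e, smooth_at F y /\
    forall i : 'I_m, `|D i y| <= `|D i e| + 1.
  apply: (filterI (near_smooth_at sF)).
  have H (i : 'I_m) : \forall y \near e, `|D i y| <= `|D i e| + 1; last first.
    exact: filter_forall H.
  near=> y.
  have : `|D i e - D i y| < 1.
    near: y; apply: cvgr_dist_lt => //.
    exact/smooth_at_continuous/smooth_at_derive.
  move=> /ltW Dy; rewrite -[D i y](subrK (D i e)) (le_trans (ler_normD _ _)) //.
  by rewrite addrC lerD2l distrC.
have [r0 /= r00 r0P] := (nbhs_ballP _ _).1 nD.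
pose C := \sum_i (`|D i e| + 1).
have C0 : 0 <= C by apply: sumr_ge0 => i _; rewrite addr_ge0.
(* Adding 1 keeps the Lipschitz constant positive even when [m = 0], where the sum [C] is empty. *)
near=> r; exists (C + 1); first by rewrite ltr_wpDl.
move=> x y xr yr; pose z t := y + t *: (x - y).
have zE t : z t - e = (1 - t) *: (y - e) + t *: (x - e).
  by apply/rowP => k; rewrite /z !mxE; ring.
have zr t : t \in `[0, 1] -> `|z t - e| <= r.
  rewrite in_itv /= => /andP[t0 t1]; rewrite zE (le_trans (ler_normD _ _)) //.
  by rewrite !normrZ !ger0_norm ?subr_ge0 //; nra.
have r1 : r < r0 by near: r; exact: nbhs_right_lt.
have zP t : t \in `[0, 1] -> smooth_at F (z t) /\
    forall i : 'I_m, `|D i (z t)| <= `|D i e| + 1.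
  move=> t01; apply: r0P; rewrite -ball_normE /ball_ /= distrC.
  exact: le_lt_trans (zr t t01) r1.
have -> : F x - F y = (F \o z) 1 - (F \o z) 0.
  by rewrite /= /z scale1r scale0r addr0 (addrC y) subrK.
have -> : (C + 1) * `|x - y| = (C + 1) * `|x - y| * `|1 - 0 : R|.
  by rewrite subr0 normr1 mulr1.
apply: (MVT_le (df := fun t => 'd F (z t) (x - y))) => t.
rewrite (min_idPl ler01) (max_idPr ler01) => t01.
have [sz Dz] := zP t t01; have dFz := smooth_at_differentiable sz.
have [dzt dztE] := line_differentiable y (x - y) t.
split.
  apply: DeriveDef; first exact/diff_derivable/differentiable_comp.
  apply: etrans (deriveE _ (differentiable_comp dzt dFz)) _.
  apply: etrans (diff_compE _ dzt dFz) _.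
  exact: congr1 _ (etrans (dztE 1) (scale1r _)).
rewrite [X in 'd F _ X]row_sum_delta linear_sum.
apply: le_trans (ler_norm_sum _ _ _) _.
apply: (@le_trans _ _ (\sum_i `|x - y| * (`|D i e| + 1))); last first.
  by rewrite -mulr_sumr mulrC ler_wpM2r // lerDl.
apply: ler_sum => i _; rewrite linearZ normrZ -deriveE //.
by rewrite ler_pM // ?rV_coord_le // Dz.
Unshelve. all: by end_near. Qed.

(** A ball of the maximum norm is a cube, so clamping each coordinate retracts the space onto it
    without increasing distances. *)
Definition clamp_rV (e : 'rV[R]_n) (r : R) (x : 'rV[R]_n) : 'rV[R]_n :=
  \row_i clamp (e ord0 i - r) (e ord0 i + r) (x ord0 i).

Lemma clamp_rV_ball e r x : 0 <= r -> `|clamp_rV e r x - e| <= r.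
Proof.
move=> r0; apply: rV_norm_le => // i; rewrite !mxE ler_distl.
by apply: clamp_bounds; lra.
Qed.

Lemma clamp_rV_id e r x : `|x - e| <= r -> clamp_rV e r x = x.
Proof.
move=> xr; apply/rowP => i; rewrite mxE clamp_id // -ler_distl.
by apply: le_trans xr; have := rV_coord_le (x - e) i; rewrite !mxE.
Qed.

Lemma clamp_rV_lipschitz e r x y :
  `|clamp_rV e r x - clamp_rV e r y| <= `|x - y|.
Proof.
apply: rV_norm_le => // i; rewrite !mxE (le_trans (clamp_lipschitz _ _ _ _)) //.
by have := rV_coord_le (x - y) i; rewrite !mxE.
Qed.

Definition integral_curve_in (F : 'rV[R]_n -> 'rV[R]_n) e (r : R)
    (g : R -> 'rV[R]_n) (t : R) :=
  `|g t - e| <= r /\ is_derive t 1 g (F (g t)).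

(** The solution of the clamped equation stays in the ball for a short time by continuity, and there
    it solves the original equation. Existence and uniqueness are stated together because they must
    share [r] and [A] when curves are compared later. *)
Lemma ode_local (F : 'rV[R]_n -> 'rV[R]_n) e (P : set 'rV[R]_n) :
  smooth_at F e -> nbhs e P ->
  exists r A : R, [/\ 0 < r, 0 < A,
    forall x, `|x - e| <= r -> P x,
    exists2 g, g 0 = e & forall t, `|t| < A -> integral_curve_in F e r g t
  & forall g1 g2 B, 0 < B -> B <= A -> g1 0 = g2 0 ->
      (forall t, `|t| <= B -> integral_curve_in F e r g1 t) ->
      (forall t, `|t| <= B -> integral_curve_in F e r g2 t) ->
      forall t, `|t| <= B -> g1 t = g2 t].
Proof.
move=> sF nP; have [r0 /= r00 r0P] := (nbhs_ballP _ _).1 nP.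
have [r [rgt0 rr0 [L L0 FL]]] : exists r, [/\ 0 < r, r < r0 & exists2 L, 0 < L &
    forall x y, `|x - e| <= r -> `|y - e| <= r -> `|F x - F y| <= L * `|x - y|].
  near (0 : R)^'+ => r; exists r; split; first by near: r; exact: nbhs_right_gt.
    by near: r; exact: nbhs_right_lt.
  by near: r; exact: smooth_at_locally_lipschitz.
have rP x : `|x - e| <= r -> P x.
  move=> xr; apply: r0P; rewrite -ball_normE /ball_ /= distrC.
  exact: le_lt_trans rr0.
(* Clamping to a ball makes [F] globally Lipschitz. *)
pose G := F \o clamp_rV e r.
have GL x y : `|G x - G y| <= L * `|x - y|.
  apply: le_trans (FL _ _ (clamp_rV_ball _ _ (ltW rgt0))
    (clamp_rV_ball _ _ (ltW rgt0))) _.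
  by rewrite ler_pM2l // clamp_rV_lipschitz.
have GF x : `|x - e| <= r -> G x = F x by move=> xr; rewrite /G /= clamp_rV_id.
pose delta := (2 * L)^-1.
have delta0 : 0 < delta by rewrite invr_gt0 mulr_gt0.
have deltaE : 2 * L * delta = 1 by rewrite mulfV // gt_eqF // mulr_gt0.
have [g g0 dg] := lipschitz_ode_exists L0 GL delta0 deltaE e.
have [A1 A10 A1P] : exists2 A1 : R, 0 < A1 &
    forall t, `|t| < A1 -> `|g t - e| <= r.
  have d00 : `|0 : R| < delta by rewrite normr0.
  have cg : {for (0 : R), continuous g}.
    have [/derivable1_diffP + _] := dg 0 d00.
    by move=> /differentiable_continuous.
  have /nbhs_ballP[A1 /= A10 A1P] : \forall t \near (0 : R), `|g t - e| < r.
    near=> t; rewrite distrC -g0; near: t; apply: cvgr_dist_lt => //.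
  exists A1 => // t tA; apply/ltW/A1P.
  by rewrite -ball_normE /ball_ /= sub0r normrN.
exists r, (Num.min A1 delta); split=> //.
- by rewrite lt_min A10.
- exists g => // t; rewrite lt_min => /andP[tA1 td]; split; first exact: A1P.
  by rewrite -GF; [exact: dg|exact: A1P].
- move=> g1 g2 B B0; rewrite le_min => /andP[_ Bd] g12 dg1 dg2.
  have G1 (t : R) : `|t| <= B -> is_derive t 1 g1 (G (g1 t)).
    by move=> /dg1[gr dgt]; rewrite GF.
  have G2 (t : R) : `|t| <= B -> is_derive t 1 g2 (G (g2 t)).
    by move=> /dg2[gr dgt]; rewrite GF.
  exact: (lipschitz_ode_unique L0 GL deltaE B0 Bd g12 G1 G2).
Unshelve. all: by end_near. Qed.

(** Bootstrap: if [g] has order [k], so has its derivative [F \o g], and then [g] has order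
    [k.+1]. *)
Lemma ode_smooth (F : 'rV[R]_n -> 'rV[R]_n) (g : R -> 'rV[R]_n) (A : R) :
  (forall t : R, `|t| < A -> is_derive t 1 g (F (g t)) /\ smooth_at F (g t)) ->
  forall t : R, `|t| < A -> smooth_at (g : R^o -> 'rV[R]_n) t.
Proof.
move=> gF t tA; pose U : set R^o := [set s : R | `|s| < A].
have oU : open U.
  rewrite (_ : U = ball (0 : R^o) A); first exact: ball_open.
  by apply/seteqP; split => s; rewrite -ball_normE /ball_ /= sub0r normrN.
apply: (smooth_on_smooth_at oU tA); apply/smooth_onP; elim=> [//|k IH].
split=> [s sA|v]; first by apply/derivable1_diffP; have [[]] := gF s sA.
have Cv : Ck k U (fun s => (cst v : R^o -> R^o) s *: (F \o g) s).
  apply: (CkZ oU); first exact: Ck_cst.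
  apply: (Ck_comp (finite_dim_rV _) oU (open_smooth_at F)) => //.
    by move=> s sA; have [] := gF s sA.
  exact: Ck_smooth_at.
apply: (Ck_ext oU) Cv => s /[!inE] sA.
have [[dg gE] _] := gF s sA; have {dg}dg := (derivable1_diffP _ _).1 dg.
rewrite (deriveE _ dg) /= -gE (deriveE _ dg) -linearZ.
by congr ('d g s _); rewrite /GRing.scale /= mulr1.
Qed.

End LocalODE.

(** * Charts and tangent maps *)

Section Charts.
Context {R : realType} {T : topologicalType} {E : normedModType R}.
Variables (c : chart T E) (p : T).
Hypotheses (cc : is_chart c) (cp : dom c p).

Lemma within_open_continuous_at (S S' : topologicalType) (A : set S)
    (f : S -> S') x :
  open A -> A x -> {within A, continuous f} -> {for x, continuous f}.
Proof.
move=> oA Ax; rewrite continuous_open_subspace // => cf.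
by apply: cf; rewrite inE.
Qed.

Lemma near_dom : \forall q \near p, dom c q.
Proof. by have [oc _ _ _ _] := cc; exact: (open_nbhs_nbhs (conj oc cp)). Qed.

Lemma near_image : \forall x \near cmap c p, (cmap c @` dom c) x.
Proof.
have [_ oc _ _ _] := cc.
have ip : (cmap c @` dom c) (cmap c p) by exists p.
exact: (open_nbhs_nbhs (conj oc ip)).
Qed.

Lemma cinvK : cinv c (cmap c p) = p.
Proof. by have [_ _ cK _ _] := cc; exact: cK. Qed.

Lemma cinv_continuous : {for cmap c p, continuous (cinv c)}.
Proof.
have [_ oc _ _ cf] := cc; by apply: within_open_continuous_at cf => //; exists p.
Qed.

Lemma near_cinv : \forall x \near cmap c p,
  dom c (cinv c x) /\ cmap c (cinv c x) = x.
Proof.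
apply: filterS near_image => _ [q qc <-].
by have [_ _ cK _ _] := cc; rewrite cK.
Qed.

Lemma near_chart (P : set T) :
  (\forall q \near p, P q) -> \forall x \near cmap c p, P (cinv c x).
Proof. by move=> nP; apply: cinv_continuous; rewrite cinvK. Qed.

End Charts.

Lemma prod_chart_is_chart (R : realType) (T T' : topologicalType)
    (E E' : normedModType R) (c : chart T E) (d : chart T' E') :
  is_chart c -> is_chart d -> is_chart (prod_chart c d).
Proof.
move=> [oc oic cK cf cif] [od oid dK df dif].
have imE : cmap (prod_chart c d) @` dom (prod_chart c d) =
    (cmap c @` dom c) `*` (cmap d @` dom d).
  apply/seteqP; split=> [_ [[p q] [/= cp dq] <-]|[x y] [/= [p cp <-] [q dq <-]]].
    by split; [exists p|exists q].
  by exists (p, q).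
have oX (S S' : topologicalType) (A : set S) (B : set S') :
    open A -> open B -> open (A `*` B).
  move=> oA oB; rewrite openE => -[x y] [/= Ax By]; exists (A, B) => //.
  by split; exact: open_nbhs_nbhs.
split=> [||[p q] [/= cp dq]||].
- exact: oX.
- by rewrite imE; exact: oX.
- by rewrite cK // dK.
- rewrite continuous_open_subspace; last exact: oX.
  move=> [p q] /[!inE] -[/= cp dq].
  apply: cvg_pair.
    apply: (@continuous_comp _ _ _ fst (cmap c)); first exact: cvg_fst.
    exact: within_open_continuous_at oc cp cf.
  apply: (@continuous_comp _ _ _ snd (cmap d)); first exact: cvg_snd.
  exact: within_open_continuous_at od dq df.
- rewrite imE continuous_open_subspace; last exact: oX.
  move=> [p q] /[!inE] -[/= cp dq].
  apply: cvg_pair.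
    apply: (@continuous_comp _ _ _ fst (cinv c)); first exact: cvg_fst.
    exact: within_open_continuous_at oic cp cif.
  apply: (@continuous_comp _ _ _ snd (cinv d)); first exact: cvg_snd.
  exact: within_open_continuous_at oid dq dif.
Qed.

(** * Pointwise smoothness of maps between spaces with charts *)

Section SmoothBetweenAt.
Context {R : realType}.

Definition smooth_between_at (T T' : topologicalType) (E E' : normedModType R)
    (A : set (chart T E)) (B : set (chart T' E')) (f : T -> T') (p : T) : Prop :=
  {for p, continuous f} /\
  forall c d, A c -> dom c p -> B d -> dom d (f p) ->
    smooth_at (cmap d \o f \o cinv c) (cmap c p).

Lemma smooth_between_smooth_at (T T' : topologicalType)
    (E E' : normedModType R) (A : set (chart T E)) (B : set (chart T' E'))
    (D : set T) (f : T -> T') p :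
  (forall c, A c -> is_chart c) -> (forall d, B d -> is_chart d) ->
  open D -> D p -> smooth_between A B D f -> smooth_between_at A B f p.
Proof.
move=> AC BC oD Dp [cf sf].
have cfp : {for p, continuous f} := within_open_continuous_at oD Dp cf.
split=> // c d Ac cp Bd dfp; move: (sf c d Ac Bd) => /smooth_onE.
move=> sfon; have [cc cd] := (AC c Ac, BC d Bd); apply: (filterS sfon).
have nD : \forall q \near p, (dom c `&` D `&` f @^-1` dom d) q.
  apply: filterI; last exact: (cfp _ (near_dom cd dfp)).
  by apply: filterI; [exact: near_dom|exact: open_nbhs_nbhs].
near=> x; have [_ <-] : dom c (cinv c x) /\ cmap c (cinv c x) = x.
  by near: x; exact: near_cinv.
by exists (cinv c x) => //; near: x; exact: near_chart.
Unshelve. all: by end_near. Qed.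

Lemma smooth_between_at_comp (T T' T'' : topologicalType)
    (E E' E'' : normedModType R) (A : set (chart T E)) (B : set (chart T' E'))
    (C : set (chart T'' E'')) (f : T -> T') (g : T' -> T'') p :
  finite_dim E' ->
  (forall c, A c -> is_chart c) -> (forall d, B d -> is_chart d) ->
  (exists2 d, B d & dom d (f p)) ->
  smooth_between_at A B f p -> smooth_between_at B C g (f p) ->
  smooth_between_at A C (g \o f) p.
Proof.
move=> fE' AC BC [d Bd dfp] [cf sf] [cg sg].
split=> [|c e Ac cp Ce egfp]; first exact: continuous_comp.
have [cc cd] := (AC c Ac, BC d Bd).
have cK := cinvK cc cp.
have := smooth_at_comp (g := cmap e \o g \o cinv d) (f := cmap d \o f \o cinv c)
  (x := cmap c p).
rewrite /= cK => /(_ fE' (sg d e Bd dfp Ce egfp) (sf c d Ac cp Bd dfp)).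
apply: smooth_at_near_eq; near=> x => /=; rewrite cinvK //.
near: x; apply: (near_chart cc cp (P := fun q => dom d (f q))).
exact: (cf _ (near_dom cd dfp)).
Unshelve. all: by end_near. Qed.

End SmoothBetweenAt.

Section ManifoldMaps.
Context {R : realType}.
Implicit Types M N K L : manifoldType R.

Definition prod_charts M N :
    set (chart (M * N) ('rV[R]_(@mdim R M) * 'rV[R]_(@mdim R N))) :=
  [set e | exists c d, [/\ charts c, charts d & e = prod_chart c d]].

Lemma charts_is_chart M (c : chart M 'rV[R]_(@mdim R M)) :
  charts c -> is_chart c.
Proof. exact: atlas_is_chart. Qed.

Lemma charts_at_is_chart M (p : M) c : charts_at p c -> is_chart c.
Proof. by move=> [/charts_is_chart]. Qed.

Lemma charts_at_chart_at M (p : M) : charts_at p (@chart_at R M p).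
Proof. by split; [exact: atlas_chart_at|exact: dom_chart_at]. Qed.

Lemma prod_charts_is_chart M N e : @prod_charts M N e -> is_chart e.
Proof.
by move=> [c [d [cc cd ->]]]; apply: prod_chart_is_chart; exact: charts_is_chart.
Qed.

Definition smooth1_at M N (f : M -> N) (p : M) : Prop :=
  smooth_between_at (@charts R M) (@charts R N) f p.

Definition smooth2_at M N K (F : M * N -> K) (pq : M * N) : Prop :=
  smooth_between_at (@prod_charts M N) (@charts R K) F pq.

Lemma smooth_smooth1_at M N (D : set M) (f : M -> N) p :
  open D -> D p -> smooth D f -> smooth1_at f p.
Proof. by apply: smooth_between_smooth_at => c; exact: charts_is_chart. Qed.

Lemma smooth2_smooth2_at M N K (D : set (M * N)) (F : M * N -> K) p :
  open D -> D p -> smooth2 D F -> smooth2_at F p.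
Proof.
by apply: smooth_between_smooth_at => c; [exact: prod_charts_is_chart|
  exact: charts_is_chart].
Qed.

Lemma smooth1_at_comp M N K (g : N -> K) (f : M -> N) p :
  smooth1_at f p -> smooth1_at g (f p) -> smooth1_at (g \o f) p.
Proof.
apply: smooth_between_at_comp; [exact: charts_is_chart|exact: charts_is_chart|].
by have [] := charts_at_chart_at (f p); exists (chart_at (f p)).
Qed.

Lemma smooth1_at_cst M N (q : N) (p : M) : smooth1_at (fun=> q) p.
Proof.
split=> [|c d _ _ _ _]; first exact: cvg_cst.
exact: smooth_at_cst.
Qed.

Lemma smooth_at_transition M (p : M) c d : charts_at p c -> charts_at p d ->
  smooth_at (cmap d \o cinv c) (cmap c p).
Proof.
move=> [cc cp] [cd dp]; have /smooth_onE := @atlas_compatible R M c d cc cd.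
move=> H; apply: (filterS H); have ccc := charts_is_chart cc.
near=> x; have [_ <-] : dom c (cinv c x) /\ cmap c (cinv c x) = x.
  by near: x; exact: (near_cinv ccc cp).
exists (cinv c x) => //; near: x.
apply: (near_chart ccc cp (P := dom c `&` dom d)).
by apply: filterI; apply: near_dom => //; exact: charts_is_chart.
Unshelve. all: by end_near. Qed.

Lemma smooth1_at_id M (p : M) : smooth1_at (@idfun M) p.
Proof.
split=> [|c d cc cp cd dp]; first exact: cvg_id.
exact: smooth_at_transition.
Qed.

Lemma smooth2_at_pair M N L (f : L -> M) (g : L -> N) p :
  smooth1_at f p -> smooth1_at g p ->
  smooth_between_at (@charts R L) (@prod_charts M N) (fun x => (f x, g x)) p.
Proof.
move=> [cf sf] [cg sg]; split=> [|c _ cc cp [d [d' [cd cd' ->]]] [/= dfp d'gp]].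
  exact: cvg_pair.
exact: smooth_at_pair (sf c d cc cp cd dfp) (sg c d' cc cp cd' d'gp).
Qed.

Lemma smooth2_at_comp M N K L (F : M * N -> K) (f : L -> M) (g : L -> N) p :
  smooth1_at f p -> smooth1_at g p -> smooth2_at F (f p, g p) ->
  smooth1_at (fun x => F (f x, g x)) p.
Proof.
move=> sf sg sF; apply: smooth_between_at_comp (smooth2_at_pair sf sg) sF.
- exact: charts_is_chart.
- exact: prod_charts_is_chart.
- have [[cf cfp] [cg cgp]] :=
    (charts_at_chart_at (f p), charts_at_chart_at (g p)).
  exists (prod_chart (chart_at (f p)) (chart_at (g p))); last by split.
  by exists (chart_at (f p)), (chart_at (g p)).
Qed.

Lemma smooth2_at_partial1 M N K (F : M * N -> K) p q :
  smooth2_at F (p, q) -> smooth1_at (fun x => F (x, q)) p.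
Proof.
by apply: smooth2_at_comp; [exact: smooth1_at_id|exact: smooth1_at_cst].
Qed.

Lemma smooth2_at_partial2 M N K (F : M * N -> K) p q :
  smooth2_at F (p, q) -> smooth1_at (fun y => F (p, y)) q.
Proof.
by apply: smooth2_at_comp; [exact: smooth1_at_cst|exact: smooth1_at_id].
Qed.

Lemma smooth1_at_chart M N (f : M -> N) p c d : smooth1_at f p ->
  charts_at p c -> charts_at (f p) d ->
  smooth_at (cmap d \o f \o cinv c) (cmap c p).
Proof. by move=> [_ sf] [cc cp] [cd dfp]; exact: sf. Qed.

End ManifoldMaps.

Lemma near_eq_diffE {R : realType} (V W : normedModType R) (f g : V -> W) x v :
  (\forall y \near x, f y = g y) -> differentiable f x -> 'd g x v = 'd f x v.
Proof.
move=> fg df; have E := near_eq_diff fg df.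
exact: (congr1 (fun k => k v) E).
Qed.

Lemma diff_comp_near {R : realType} (U V W : normedModType R) (f : U -> V)
    (g : V -> W) (h : U -> W) x y v :
  f x = y -> differentiable f x -> differentiable g y ->
  (\forall z \near x, g (f z) = h z) -> 'd h x v = 'd g y ('d f x v).
Proof.
move=> <- df dg fgh; rewrite -(diff_compE _ df dg).
have E := near_eq_diff fgh (differentiable_comp df dg).
exact: (congr1 (fun k => k v) E).
Qed.

(** * Calculus of tangent vectors and tangent maps *)

Section TangentMaps.
Context {R : realType}.
Implicit Types M N K L : manifoldType R.

Lemma tangent_transition M (p : M) (v : tvec M) c d :
  tangent p v -> charts_at p c -> charts_at p d ->
  v d = 'd (cmap d \o cinv c) (cmap c p) (v c).
Proof. by move=> [tv _]; exact: tv. Qed.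

(** Reduces an identity between tangent vectors, which are families over all charts, to a
    computation in a single chart. *)
Lemma tangent_ext M (p : M) (v w : tvec M) c :
  tangent p v -> tangent p w -> charts_at p c -> v c = w c -> v = w.
Proof.
move=> tv tw pc vw; apply/funext => d.
have [pd|npd] := pselect (charts_at p d).
  by rewrite (tangent_transition tv pc pd) (tangent_transition tw pc pd) vw.
by rewrite tv.2 // tw.2.
Qed.

Lemma tangentD M (p : M) (v w : tvec M) a :
  tangent p v -> tangent p w -> tangent p (a *: v + w).
Proof.
move=> tv tw; split=> [c d pc pd|c npc].
  rewrite -[LHS]/(a *: v d + w d) -[(a *: v + w) c]/(a *: v c + w c).
  by rewrite linearP (tangent_transition tv pc pd) (tangent_transition tw pc pd).
by rewrite -[LHS]/(a *: v c + w c) tv.2 // tw.2 // scaler0 addr0.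
Qed.

Lemma tangent0 M (p : M) : tangent p (0 : tvec M).
Proof. by split=> [c d _ _|//]; rewrite linear0. Qed.

Lemma near_charts_at M N (f : M -> N) p c d : {for p, continuous f} ->
  charts_at p c -> charts_at (f p) d ->
  \forall x \near cmap c p, charts_at (cinv c x) c /\ charts_at (f (cinv c x)) d.
Proof.
move=> cf [cc cp] [cd dfp]; apply: (near_chart (charts_is_chart cc) cp
  (P := fun q => charts_at q c /\ charts_at (f q) d)); apply: filterI.
  by apply: filterS (near_dom (charts_is_chart cc) cp) => q.
have nf : \forall q \near p, dom d (f q).
  exact: (cf _ (near_dom (charts_is_chart cd) dfp)).
by apply: filterS nf => q.
Qed.

(** Frees [tmap] from the chart [chart_at p] of its definition: the transition map that relates the
    components of [v] cancels the change of chart by the chain rule. *)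
Lemma tmapE M N (f : M -> N) p (v : tvec M) c d : smooth1_at f p ->
  tangent p v -> charts_at p c -> charts_at (f p) d ->
  tmap f p v d = 'd (cmap d \o f \o cinv c) (cmap c p) (v c).
Proof.
move=> sf tv pc fpd; rewrite /tmap asboolT //.
have pc0 := charts_at_chart_at p; set c0 := chart_at p in pc0 *.
rewrite (tangent_transition tv pc pc0).
have d1 := smooth_at_differentiable (smooth_at_transition pc pc0).
have d2 := smooth_at_differentiable (smooth1_at_chart sf pc0 fpd).
have cK := cinvK (charts_at_is_chart pc) pc.2.
have E1 : (cmap c0 \o cinv c) (cmap c p) = cmap c0 p by rewrite /= cK.
apply/esym/(diff_comp_near (v c) E1 d1 d2).
have H := near_charts_at (@cvg_id _ _) pc pc0.
apply: filterS H => x [_ [c0c c0x]] /=.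
by rewrite cinvK //; exact: charts_is_chart.
Qed.

Lemma tmap_tangent M N (f : M -> N) p (v : tvec M) : smooth1_at f p ->
  tangent p v -> tangent (f p) (tmap f p v).
Proof.
move=> sf tv; split=> [c d fpc fpd|c nc]; last by rewrite /tmap asboolF.
have pc0 := charts_at_chart_at p; set c0 := chart_at p in pc0.
rewrite (tmapE sf tv pc0 fpd) (tmapE sf tv pc0 fpc).
have d1 := smooth_at_differentiable (smooth1_at_chart sf pc0 fpc).
have d2 := smooth_at_differentiable (smooth_at_transition fpc fpd).
have cK := cinvK (charts_at_is_chart pc0) pc0.2.
have E1 : (cmap c \o f \o cinv c0) (cmap c0 p) = cmap c (f p) by rewrite /= cK.
apply: (diff_comp_near (v c0) E1 d1 d2).
apply: filterS (near_charts_at sf.1 pc0 fpc) => x [_ [cc cfx]] /=.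
by rewrite cinvK //; exact: charts_is_chart.
Qed.

Lemma tmap_comp M N K (f : M -> N) (g : N -> K) p (v : tvec M) :
  smooth1_at f p -> smooth1_at g (f p) -> tangent p v ->
  tmap (g \o f) p v = tmap g (f p) (tmap f p v).
Proof.
move=> sf sg tv.
have sgf := smooth1_at_comp sf sg; have tfv := tmap_tangent sf tv.
have pc := charts_at_chart_at p; have fpd := charts_at_chart_at (f p).
have gfpe := charts_at_chart_at (g (f p)).
apply: (tangent_ext (tmap_tangent sgf tv) (tmap_tangent sg tfv) gfpe).
rewrite (tmapE sgf tv pc gfpe) (tmapE sg tfv fpd gfpe) (tmapE sf tv pc fpd).
set c := chart_at p in pc *; set d := chart_at (f p) in fpd *.
set e := chart_at (g (f p)) in gfpe *.
have d1 := smooth_at_differentiable (smooth1_at_chart sf pc fpd).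
have d2 := smooth_at_differentiable (smooth1_at_chart sg fpd gfpe).
have cK := cinvK (charts_at_is_chart pc) pc.2.
have E1 : (cmap d \o f \o cinv c) (cmap c p) = cmap d (f p) by rewrite /= cK.
apply: (diff_comp_near (v c) E1 d1 d2).
apply: filterS (near_charts_at sf.1 pc fpd) => x [_ [cc cfx]] /=.
by rewrite cinvK //; exact: charts_is_chart.
Qed.

Lemma tmap_near_eq M N (f g : M -> N) p (v : tvec M) :
  (\forall q \near p, f q = g q) -> smooth1_at f p -> tmap g p v = tmap f p v.
Proof.
move=> fg sf; apply/funext => d; rewrite /tmap.
have fgp := nbhs_singleton fg; rewrite -fgp.
case: asboolP => [fpd|_]; last reflexivity.
have pc := charts_at_chart_at p.
have d1 := smooth_at_differentiable (smooth1_at_chart sf pc fpd).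
apply: (near_eq_diffE _ _ d1).
have := near_chart (charts_at_is_chart pc) pc.2 fg.
by apply: filterS => x /= ->.
Qed.

Lemma tmap_id M p (v : tvec M) : tangent p v -> tmap idfun p v = v.
Proof.
move=> tv; have pc := charts_at_chart_at p.
apply: (tangent_ext (tmap_tangent (smooth1_at_id p) tv) tv pc).
by rewrite (tmapE (smooth1_at_id p) tv pc pc) [RHS](tangent_transition tv pc pc).
Qed.

Lemma tmap_cst M N (q : N) p (v : tvec M) : tmap (fun=> q) p v = 0.
Proof.
apply/funext => d; rewrite /tmap; case: asboolP => // _.
exact: (congr1 (@^~ _) (diff_cst _ _)).
Qed.

Lemma tmapP M N (f : M -> N) p a (v w : tvec M) :
  tmap f p (a *: v + w) = a *: tmap f p v + tmap f p w.
Proof.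
apply/funext => d; rewrite -[RHS]/(a *: tmap f p v d + tmap f p w d) /tmap.
case: asboolP => _; last by rewrite scaler0 addr0.
by rewrite -linearP.
Qed.

Lemma tmapD M N (f : M -> N) p (v w : tvec M) :
  tmap f p (v + w) = tmap f p v + tmap f p w.
Proof. by have := tmapP f p 1 v w; rewrite !scale1r. Qed.

Lemma tmap0 M N (f : M -> N) p : tmap f p 0 = 0.
Proof. by have := tmapP f p (-1) 0 0; rewrite scaler0 addr0 scaleN1r addNr. Qed.

Lemma tmapZ M N (f : M -> N) p a (v : tvec M) :
  tmap f p (a *: v) = a *: tmap f p v.
Proof. by have := tmapP f p a v 0; rewrite tmap0 !addr0. Qed.

Lemma tmapB M N (f : M -> N) p (v w : tvec M) :
  tmap f p (v - w) = tmap f p v - tmap f p w.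
Proof. by rewrite tmapD -scaleN1r tmapZ scaleN1r. Qed.

End TangentMaps.

(** * One-parameter subgroups *)

Section Curves.
Context {R : realType}.
Implicit Types M N : manifoldType R.

Definition smooth_curve_at M (g : R -> M) (t : R) : Prop :=
  smooth_between_at (E := R^o) [set @id_chart R] (@charts R M) g t.

Lemma id_chart_is_chart : @is_chart R R R^o (@id_chart R).
Proof.
split=> //=; first exact: openT.
- rewrite image_id; exact: openT.
- by apply: continuous_subspaceT => x; exact: cvg_id.
- by apply: continuous_subspaceT => x; exact: cvg_id.
Qed.

Lemma smooth_curveP M (g : R -> M) :
  smooth_curve g <-> forall t, smooth_curve_at g t.
Proof.
split=> [sg t|sg].
  apply: (smooth_between_smooth_at _ _ openT I sg) => c.
    by move=> ->; exact: id_chart_is_chart.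
  exact: charts_is_chart.
split=> [|c d -> Bd].
  by apply: continuous_subspaceT => t; have [] := sg t.
apply: smooth_at_smooth_on => _ [t [_ dgt] <-].
by have [_ sgt] := sg t; exact: sgt.
Qed.

Lemma smooth_curve_at_chart M (g : R -> M) t d :
  smooth_curve_at g t -> charts_at (g t) d ->
  smooth_at (cmap d \o g : R^o -> _) t.
Proof. by move=> [_ sg] [cd dgt]; exact: (sg (@id_chart R) d). Qed.

Lemma smooth_curve_at_comp M N (f : M -> N) (g : R -> M) t :
  smooth_curve_at g t -> smooth1_at f (g t) -> smooth_curve_at (f \o g) t.
Proof.
apply: smooth_between_at_comp => [c ->||].
- exact: id_chart_is_chart.
- exact: charts_is_chart.
by have [] := charts_at_chart_at (g t); exists (chart_at (g t)).
Qed.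

Lemma smooth_curve_at_reparam M (g : R -> M) (h : R^o -> R^o) (t : R) :
  smooth_at h t -> smooth_curve_at g (h t) -> smooth_curve_at (g \o h) t.
Proof.
move=> sh [cg sg]; split=> [|c d -> _ Bd dght].
  by apply: continuous_comp => //; exact: smooth_at_continuous.
have sgh : smooth_at (cmap d \o g : R^o -> _) (h t).
  exact: (sg (@id_chart R) d erefl I Bd dght).
change (smooth_at ((cmap d \o g : R^o -> _) \o h) t).
exact: (smooth_at_comp sgh sh).
Qed.

Lemma smooth_curve_at_near_eq M (f g : R -> M) (t : R) :
  (\forall s \near t, f s = g s) -> smooth_curve_at f t -> smooth_curve_at g t.
Proof.
move=> fg [cf sf]; have fgt := nbhs_singleton fg.
split=> [|c d -> _ Bd dgt].
  suff : g s @[s --> t] --> g t by [].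
  by rewrite -fgt; apply: cvg_trans cf; exact: near_eq_cvg fg.
have := sf (@id_chart R) d erefl I Bd; rewrite fgt => /(_ dgt).
by apply: smooth_at_near_eq; apply: filterS fg => s /= ->.
Qed.

Lemma velocityE M (g : R -> M) t d :
  smooth_curve_at g t -> charts_at (g t) d ->
  velocity g t d = 'd (cmap d \o g : R^o -> _) t 1.
Proof.
move=> sg gtd; rewrite /velocity asboolT // derive1E deriveE //.
exact/smooth_at_differentiable/smooth_curve_at_chart.
Qed.

Lemma velocity_tangent M (g : R -> M) t :
  smooth_curve_at g t -> tangent (g t) (velocity g t).
Proof.
move=> sg; split=> [c d gtc gtd|c nc]; last by rewrite /velocity asboolF.
rewrite (velocityE sg gtc) (velocityE sg gtd).
have d1 := smooth_at_differentiable (smooth_curve_at_chart sg gtc).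
have d2 := smooth_at_differentiable (smooth_at_transition gtc gtd).
apply: (diff_comp_near _ _ d1 d2) => //.
have nf : \forall s \near t, dom c (g s).
  exact: (sg.1 _ (near_dom (charts_at_is_chart gtc) gtc.2)).
by apply: filterS nf => s cs /=; rewrite cinvK //; exact: charts_at_is_chart gtc.
Qed.

Lemma velocity_comp M N (f : M -> N) (g : R -> M) t :
  smooth_curve_at g t -> smooth1_at f (g t) ->
  velocity (f \o g) t = tmap f (g t) (velocity g t).
Proof.
move=> sg sf; have sfg := smooth_curve_at_comp sg sf.
have tg := velocity_tangent sg.
have gtc := charts_at_chart_at (g t); have fgtd := charts_at_chart_at (f (g t)).
apply: (tangent_ext (velocity_tangent sfg) (tmap_tangent sf tg) fgtd).
rewrite (tmapE sf tg gtc fgtd) (velocityE sg gtc) (velocityE sfg fgtd).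
set c := chart_at (g t) in gtc *; set d := chart_at (f (g t)) in fgtd *.
have d1 := smooth_at_differentiable (smooth_curve_at_chart sg gtc).
have d2 := smooth_at_differentiable (smooth1_at_chart sf gtc fgtd).
apply: (diff_comp_near _ _ d1 d2) => //.
have nf : \forall s \near t, dom c (g s).
  exact: (sg.1 _ (near_dom (charts_at_is_chart gtc) gtc.2)).
by apply: filterS nf => s cs /=; rewrite cinvK //; exact: charts_at_is_chart gtc.
Qed.

End Curves.

(** * Homomorphisms from the line are determined near 0 *)

Section DyadicExtension.
Context {R : realType} {H : groupType}.

Section Extension.
Variables (l : R -> H) (B : R).
Hypothesis lD : forall s t : R, `|s| <= B -> `|t| <= B ->
  l (s + t) = (l s * l t)%g.

Let pw n (t : R) : H := (l (t / 2 ^+ n) ^+ (2 ^ n))%g.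

Let shrink (t : R) n k : `|t / 2 ^+ n| <= B -> `|t / 2 ^+ (n + k)| <= B.
Proof.
apply: le_trans; rewrite !normrM ler_wpM2l // !normfV lef_pV2 ?posrE ?normr_gt0
  ?expf_neq0 // !ger0_norm ?exprn_ge0 // ler_eXn2l ?leq_addr //; lra.
Qed.

Let pwD (t : R) n k : `|t / 2 ^+ n| <= B -> pw (n + k) t = pw n t.
Proof.
elim: k => [|k IH] tn; first by rewrite addn0.
rewrite -IH // addnS /pw; have := shrink k.+1 tn; rewrite addnS => tk.
rewrite expnS expgnA; congr (_ ^+ _)%g.
have tE : t / 2 ^+ (n + k) = t / 2 ^+ (n + k).+1 + t / 2 ^+ (n + k).+1.
  by rewrite exprS invfM mulrCA; field; rewrite expf_neq0.
by rewrite [in RHS]tE lD // -expg2.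
Qed.

Let pwE (t : R) n m : `|t / 2 ^+ n| <= B -> `|t / 2 ^+ m| <= B -> pw n t = pw m t.
Proof. by move=> tn tm; rewrite -(pwD m tn) addnC pwD. Qed.

(** Every [n] with [|t / 2 ^+ n| <= B] gives the same power [pw n t], so [s], [t] and [s + t] can be
    evaluated at one common level. *)
Lemma local_hom_extension : 0 < B ->
  exists2 g : R -> H, (forall s t : R, g (s + t) = (g s * g t)%g) &
    forall t : R, `|t| <= B -> g t = l t.
Proof.
move=> B0; have /choice[n nP] (t : R) : exists n, `|t / 2 ^+ n| <= B.
  have [n nB] := geometric_small `|t| B0; exists n.
  by rewrite normrM normfV (ger0_norm (exprn_ge0 _ _)) // ltW.
exists (fun t => pw (n t) t) => [s t|t tB]; last first.
  rewrite (pwE (m := 0) (nP t)) ?expr0 ?divr1 //.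
  by rewrite /pw expr0 divr1 expg1.
pose N := (n s + n t + n (s + t)%R)%N.
have sN : `|s / 2 ^+ N| <= B by rewrite /N -addnA; exact: shrink.
have tN : `|t / 2 ^+ N| <= B by rewrite /N addnAC addnC; exact: shrink.
have stN : `|(s + t) / 2 ^+ N| <= B by rewrite /N addnC; exact: shrink.
rewrite (pwE (nP s) sN) (pwE (nP t) tN) (pwE (nP (s + t)) stN).
rewrite /pw mulrDl lD // expgMn //.
(* The power of a product splits because the two factors commute: their products in either order are
   the value of [l] at the same sum. *)
by rewrite /commute -!lD // addrC.
Qed.

End Extension.

Lemma hom0 (g : R -> H) : (forall s t : R, g (s + t) = (g s * g t)%g) ->
  g 0 = 1%g.
Proof. by move=> gD; apply: (@mulgI _ (g 0)); rewrite -gD addr0 mulg1. Qed.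

Lemma hom_eq_near0 (g1 g2 : R -> H) (B : R) : 0 < B ->
  (forall s t : R, g1 (s + t) = (g1 s * g1 t)%g) ->
  (forall s t : R, g2 (s + t) = (g2 s * g2 t)%g) ->
  (forall t : R, `|t| <= B -> g1 t = g2 t) -> g1 = g2.
Proof.
move=> B0 h1 h2 g12; apply/funext => t.
have pw (g : R -> H) n : (forall s t : R, g (s + t) = (g s * g t)%g) ->
    g t = (g (t / 2 ^+ n)%R ^+ (2 ^ n))%g.
  move=> hg; elim: n => [|n IH]; first by rewrite expr0 divr1 expg1.
  rewrite {1}IH expnS expgnA; congr (_ ^+ _)%g.
  have tE : t / 2 ^+ n = t / 2 ^+ n.+1 + t / 2 ^+ n.+1.
    by rewrite exprS invfM mulrCA; field; rewrite expf_neq0.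
  by rewrite [in LHS]tE hg -expg2.
have [n nB] := geometric_small `|t| B0.
rewrite (pw _ n h1) (pw _ n h2) g12 // normrM normfV.
by rewrite (ger0_norm (exprn_ge0 _ _)) // ltW.
Qed.

End DyadicExtension.

Section DerivativeRules.
Context {R : realType}.
Implicit Types U V W : normedModType R.

Lemma diff_partial2 U V W (f : U * V -> W) x y v : differentiable f (x, y) ->
  differentiable (fun w => f (x, w)) y /\
  'd (fun w => f (x, w)) y v = 'd f (x, y) (0, v).
Proof.
move=> df; have dp := differentiable_pair (differentiable_cst x y)
  (differentiable_id y).
split; first exact: (differentiable_comp dp df).
apply: etrans (diff_compE v dp df) _; congr ('d f _ _).
apply: etrans (diff_pairE v (differentiable_cst x y) (differentiable_id y)) _.
have cE := diff_cst x y.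
exact: (congr2 pair (congr1 (fun k => k v) cE) (diff_idE y v)).
Qed.

Lemma diff_partial1 U V W (f : U * V -> W) x y u : differentiable f (x, y) ->
  differentiable (fun w => f (w, y)) x /\
  'd (fun w => f (w, y)) x u = 'd f (x, y) (u, 0).
Proof.
move=> df; have dp := differentiable_pair (differentiable_id x)
  (differentiable_cst y x).
split; first exact: (differentiable_comp dp df).
apply: etrans (diff_compE u dp df) _; congr ('d f _ _).
apply: etrans (diff_pairE u (differentiable_id x) (differentiable_cst y x)) _.
have cE := diff_cst y x.
exact: (congr2 pair (diff_idE x u) (congr1 (fun k => k u) cE)).
Qed.

Lemma is_derive_diff V (f : R -> V) (t : R) v : is_derive t 1 f v ->
  differentiable f t /\ 'd f t 1 = v.
Proof.
move=> [df fv]; have {}df := (derivable1_diffP f t).1 df.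
by split=> //; rewrite -fv; exact/esym/deriveE.
Qed.

Lemma diff_is_derive V (f : R -> V) (t : R) v : differentiable f t ->
  'd f t 1 = v -> is_derive t 1 f v.
Proof.
by move=> df <-; apply: DeriveDef; [exact: diff_derivable|exact: deriveE].
Qed.

Lemma is_derive_comp V W (f : V -> W) (g : R -> V) (t : R) v :
  is_derive t 1 g v -> differentiable f (g t) ->
  is_derive t 1 (f \o g) ('d f (g t) v).
Proof.
move=> /is_derive_diff[dg <-] df; apply: diff_is_derive.
  exact: differentiable_comp.
exact: diff_compE.
Qed.

Lemma is_derive_line V (g : R -> V) (a b t : R) v :
  is_derive (a + t * b) 1 g v -> is_derive t 1 (fun s => g (a + s * b)) (b *: v).
Proof.
move=> /is_derive_diff[dg gv].
have [dl lE] := line_differentiable (V := R^o) a b t.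
apply: (@diff_is_derive _ (g \o (fun s : R => a + s *: (b : R^o)))).
  exact: (differentiable_comp dl dg).
apply: etrans (diff_compE _ dl dg) _.
apply: etrans (congr1 _ (lE 1)) _.
rewrite scale1r -gv -linearZ; congr ('d g _ _).
by rewrite /GRing.scale /= mulr1.
Qed.

Lemma smooth_at_line V (y w : V) (t : R^o) :
  smooth_at (fun s : R^o => y + s *: w) t.
Proof.
apply: smooth_atD; first exact: smooth_at_cst.
by apply: smooth_atZ; [exact: smooth_at_id|exact: smooth_at_cst].
Qed.

Lemma smooth_at_snd V W (z : V * W) : smooth_at (fun z : V * W => z.2) z.
Proof.
apply: (smooth_at_linear (l := snd : {linear (V * W)%type -> W})) => x.
exact: cvg_snd.
Qed.

End DerivativeRules.

(** * Left invariant fields in a chart at the identity *)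

Section LieGroupChart.
Context {R : realType} (H : lieGroupType R).

Lemma smooth2_at_mulg (a b : H) :
  smooth2_at (fun p : H * H => (p.1 * p.2)%g) (a, b).
Proof. by apply: (smooth2_smooth2_at openT I); exact: smooth_mulg. Qed.

Lemma smooth1_at_lmul (a b : H) : smooth1_at (fun h : H => (a * h)%g) b.
Proof. exact: (smooth2_at_partial2 (smooth2_at_mulg a b)). Qed.

Lemma smooth1_at_rmul (a b : H) : smooth1_at (fun h : H => (h * b)%g) a.
Proof. exact: (smooth2_at_partial1 (smooth2_at_mulg a b)). Qed.

Lemma smooth1_at_invg (a : H) : smooth1_at (fun h : H => (h^-1)%g) a.
Proof. by apply: (smooth_smooth1_at openT I); exact: smooth_invg. Qed.

Let c := @chart_at R H 1%g.
Let e := cmap c 1%g.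
Local Notation E := 'rV[R]_(@mdim R H).

Let c1 : charts_at 1%g c := charts_at_chart_at (1%g : H).
Let cc : is_chart c := charts_at_is_chart c1.
Let cK : cinv c e = 1%g. Proof. exact: cinvK cc c1.2. Qed.

Let mh (z : E * E) : E := cmap c (cinv c z.1 * cinv c z.2)%g.

Let smooth_mh : smooth_at mh (e, e).
Proof.
have [_ sm] := smooth2_at_mulg 1%g 1%g.
apply: (sm (prod_chart c c) c); last by rewrite /= mulg1; exact: c1.2.
- by exists c, c; split=> //; exact: c1.1.
- by split; exact: c1.2.
- exact: c1.1.
Qed.

(** Since [cinv c] is arbitrary off the image of the chart, each use of it has to be guarded; these
    two conditions hold exactly on that image. *)
Let in_chart (x : E) := dom c (cinv c x) /\ cmap c (cinv c x) = x.

Let near_in_chart : \forall x \near e, in_chart x.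
Proof. exact: near_cinv cc c1.2. Qed.

Let in_chart_e : in_chart e.
Proof. exact: nbhs_singleton near_in_chart. Qed.

Let good (z : E * E) := [/\ smooth_at mh z, in_chart z.1, in_chart z.2 &
  dom c (cinv c z.1 * cinv c z.2)%g].

Let near_good : \forall z \near (e, e), good z.
Proof.
have pc : is_chart (prod_chart c c) by exact: prod_chart_is_chart.
have n1 : \forall z \near (e, e), in_chart z.1.
  exact: (@cvg_fst _ _ _ (nbhs e) _ _ near_in_chart).
have n2 : \forall z \near (e, e), in_chart z.2.
  exact: (@cvg_snd _ _ (nbhs e) (nbhs e) _ _ near_in_chart).
have n3 : \forall z \near (e, e), dom c (cinv c z.1 * cinv c z.2)%g.
  have dp : dom (prod_chart c c) (1%g, 1%g) by split; exact: c1.2.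
  apply: (near_chart pc dp (P := fun p : H * H => dom c (p.1 * p.2)%g)).
  have [cm _] := smooth2_at_mulg 1%g 1%g.
  by apply: cm; rewrite /= mulg1; exact: near_dom cc c1.2.
near=> z; split; near: z => //.
exact: near_smooth_at smooth_mh.
Unshelve. all: by end_near. Qed.

Let mh_e x : in_chart x -> mh (x, e) = x.
Proof. by move=> [_ xE]; rewrite /mh /= cK mulg1. Qed.

Let mhe x : in_chart x -> mh (e, x) = x.
Proof. by move=> [_ xE]; rewrite /mh /= cK mul1g. Qed.

(* The left invariant vector field of value [mu] at 1, in the chart [c]. *)
Let F (mu : E) (x : E) : E := 'd mh (x, e) (0, mu).

Let smooth_F mu : smooth_at (F mu) e.
Proof.
apply: (@smooth_at_diff _ _ _ _ _ mh (fun x => (x, e)) (fun=> (0, mu))) => //.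
- by apply: smooth_at_pair; [exact: smooth_at_id|exact: smooth_at_cst].
- exact: smooth_at_cst.
Qed.

(* Differentiate mh (mh (x, y), w) = mh (x, mh (y, w)) in w at w = e. *)
Let F_mh mu : \forall z \near (e, e), F mu (mh z) = 'd mh z (0, F mu z.2).
Proof.
have nngood := nbhs_interior near_good.
have cm := smooth_at_continuous
  (smooth_at_pair smooth_mh (smooth_at_cst e (e, e))).
have c2 := smooth_at_continuous 
  (smooth_at_pair (smooth_at_snd (e, e)) (smooth_at_cst e (e, e))).
have nm : \forall z \near (e, e), good (mh z, e).
  by apply: (cm good); rewrite mh_e.
have n2 : \forall z \near (e, e), \forall w \near (z.2, e), good w.
  exact: (c2 _ nngood).
near=> z; suff key x y : good (x, y) -> good (mh (x, y), e) ->
    (\forall w \near (y, e), good w) ->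
    F mu (mh (x, y)) = 'd mh (x, y) (0, F mu y).
  rewrite [z]surjective_pairing.
  apply: key; rewrite -?surjective_pairing; near: z.
  - exact: near_good.
  - exact: nm.
  - exact: n2.
move=> [sxy /= xc yc xy] [sm _ _ _] ny.
have ye : (fun w => mh (y, w)) e = y by exact: mh_e.
have [sy _ _ _] := nbhs_singleton ny.
have [d1 F1] := diff_partial2 mu (smooth_at_differentiable sm).
have [d2 F2] := diff_partial2 mu (smooth_at_differentiable sy).
have [d3 F3] := diff_partial2 (F mu y) (smooth_at_differentiable sxy).
apply: etrans (esym F1) _; apply: etrans F3.
have -> : F mu y = 'd (fun w => mh (y, w)) e mu by exact: esym F2.
apply: (diff_comp_near (f := fun w => mh (y, w)) _ ye d2 d3).
have nw : \forall w \near e, good (y, w).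
  have ce := smooth_at_continuous
    (smooth_at_pair (smooth_at_cst y e) (smooth_at_id e)).
  exact: (ce _ ny).
apply: filterS nw => w [_ _ _ /= yw].
by rewrite /mh /= !(cinvK cc) // mulgA.
Unshelve. all: by end_near. Qed.

(** Differentiate [g s = g t * g (s - t)] in [s] at [s = t]: the velocity at [t] is the left
    translate of the velocity [mu] at time 0. *)
Let one_param_integral (mu : tvec H) (g : R -> H) :
  one_parameter_subgroup mu g ->
  \forall t \near (0 : R), in_chart (cmap c (g t)) /\
    cinv c (cmap c (g t)) = g t /\
    is_derive t 1 (cmap c \o g) (F (mu c) (cmap c (g t))).
Proof.
move=> [/smooth_curveP sg gD gmu].
have g0 := hom0 gD.
have g0c : charts_at (g 0) c by rewrite g0; exact: c1.
have ndom : \forall t \near (0 : R), dom c (g t).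
  exact: ((sg 0).1 _ (near_dom cc g0c.2)).
have cg := smooth_at_continuous (smooth_curve_at_chart (sg 0) g0c).
have nin : \forall t \near (0 : R), in_chart (cmap c (g t)).
  by apply: (cg in_chart); rewrite /= g0; exact: near_in_chart.
have nsm : \forall t \near (0 : R), smooth_at mh (cmap c (g t), e).
  have [[X Y] /= [nX nY] XY] := near_smooth_at smooth_mh.
  have nx : \forall x \near e, smooth_at mh (x, e).
    by apply: filterS nX => x Xx; apply: (XY (x, e)); split=> //;
      exact: nbhs_singleton nY.
  by apply: (cg (fun x => smooth_at mh (x, e))); rewrite /= g0; exact: nx.
near=> t; have dt : dom c (g t) by near: t.
have gtK : cinv c (cmap c (g t)) = g t by rewrite (cinvK cc).
split; first by near: t.
split=> //.
have sgt := smooth_at_differentiable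
  (smooth_curve_at_chart (sg t) (conj c1.1 dt)).
apply: (diff_is_derive sgt).
have sm : smooth_at mh (cmap c (g t), e) by near: t.
have [d2 F2] := diff_partial2 (mu c) (smooth_at_differentiable sm).
have [dl lE] := line_differentiable (V := R^o) (- t) 1 t.
have l0 : (fun s : R => - t + s *: (1 : R^o)) t = 0.
  by rewrite /GRing.scale /= mulr1 addNr.
have d0 := smooth_at_differentiable (smooth_curve_at_chart (sg 0) g0c).
have e0 : (cmap c \o g) 0 = e by rewrite /= g0.
have muE : 'd (cmap c \o g : R^o -> _) 0 1 = mu c.
  by rewrite -(velocityE (sg 0) g0c) gmu.
rewrite -e0 in d2; have d3 := differentiable_comp d0 d2.
have d3E := diff_compE (1 : R^o) d0 d2.
apply: etrans (diff_comp_near (f := fun s : R^o => - t + s *: (1 : R^o))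
  (1 : R^o) l0 dl d3 _) _.
  have [B /= B0 BP] := (nbhs_ballP _ _).1 ndom.
  near=> s; rewrite /mh /= gtK (cinvK cc).
    by rewrite -gD /GRing.scale /= mulr1 addrA subrr add0r.
  apply: BP; rewrite -ball_normE /ball_ /= sub0r normrN.
  rewrite /GRing.scale /= mulr1 addrC -normrN opprB.
  by near: s; apply: cvgr_dist_lt => //; exact: cvg_id.
rewrite lE scale1r; apply: etrans d3E _; rewrite muE.
by rewrite e0; exact: F2.
Unshelve. all: by end_near. Qed.

(** Near 0 both are integral curves of the same left invariant field from the same point, hence
    equal there; homomorphisms that agree near 0 agree everywhere. *)
Lemma one_parameter_subgroup_unique (mu : tvec H) (g1 g2 : R -> H) :
  one_parameter_subgroup mu g1 -> one_parameter_subgroup mu g2 -> g1 = g2.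
Proof.
move=> h1 h2; have [r [A [r0 A0 rP _ uniq]]] :=
  ode_local (smooth_F (mu c)) near_in_chart.
have [[s1 D1 _] [s2 D2 _]] := (h1, h2).
have nr (g : R -> H) : one_parameter_subgroup mu g ->
    \forall t \near (0 : R), `|cmap c (g t) - e| <= r.
  move=> [/smooth_curveP sg gD _].
  have g0c : charts_at (g 0) c by rewrite (hom0 gD); exact: c1.
  have cg := smooth_at_continuous (smooth_curve_at_chart (sg 0) g0c).
  near=> t; rewrite distrC ltW // /e -(hom0 gD); near: t.
  by apply: cvgr_dist_lt.
have [B /= B0 BP] := (nbhs_ballP _ _).1 (filterI
  (filterI (one_param_integral h1) (one_param_integral h2))
  (filterI (nr _ h1) (nr _ h2))).
have [C [C0 CB CA]] : exists C, [/\ 0 < C, C < B & C <= A].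
  exists (Num.min (B / 2) A); split; first by rewrite lt_min A0 divr_gt0.
    by rewrite gt_min; apply/orP; left; lra.
  by rewrite ge_min lexx orbT.
have CP t : `|t| <= C -> ball (0 : R) B t.
  by move=> tC; rewrite -ball_normE /ball_ /= sub0r normrN (le_lt_trans tC).
apply: (hom_eq_near0 C0 D1 D2) => t tC.
have [[[_ [<- _]] [_ [<- _]]] _] := BP t (CP t tC).
congr (cinv c _).
apply: (uniq (cmap c \o g1) (cmap c \o g2) C C0 CA) t tC.
- by rewrite /= (hom0 D1) (hom0 D2).
- by move=> s /CP/BP[[[_ [_ ds]] _] [rs _]].
- by move=> s /CP/BP[[_ [_ [_ ds]]] [_ rs]].
Unshelve. all: by end_near. Qed.

Lemma one_parameter_subgroup_exists (mu : tvec H) : tangent (1%g : H) mu ->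
  exists g, one_parameter_subgroup mu g.
Proof.
move=> tmu.
have nP : \forall x \near e, in_chart x /\ smooth_at (F (mu c)) x.
  exact: filterI near_in_chart (near_smooth_at (smooth_F (mu c))).
have [r [A [r0 A0 rP [y y0 yP] uniq]]] := ode_local (smooth_F (mu c)) nP.
have ys (t : R) : `|t| < A -> smooth_at (y : R^o -> _) t.
  apply: (ode_smooth (F := F (mu c))) => s /yP[rs ds]; split=> //.
  by have [] := rP _ rs.
have A00 : `|0 : R| < A by rewrite normr0.
have cy := smooth_at_continuous (ys 0 A00).
have cmy : \forall z \near (e, e), `|mh z - e| <= r.
  have cm := smooth_at_continuous smooth_mh.
  near=> z; rewrite distrC ltW // -{1}(mh_e in_chart_e); near: z.
  by apply: cvgr_dist_lt.
have [B /= B0 BP] : exists2 B, 0 < B & forall s t : R, `|s| < B -> `|t| < B ->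
   [/\ good (y s, y t), F (mu c) (mh (y s, y t)) =
      'd mh (y s, y t) (0, F (mu c) (y t)) & `|mh (y s, y t) - e| <= r].
  have nz : \forall z \near (e, e), [/\ good z,
      F (mu c) (mh z) = 'd mh z (0, F (mu c) z.2) & `|mh z - e| <= r].
    near=> z; split; near: z => //.
    exact: F_mh.
  have [[X Y] /= [nX nY] XY] := nz; rewrite -y0 in nX nY.
  have nXY : \forall t \near (0 : R), X (y t) /\ Y (y t).
    by apply: filterI; [exact: (cy X)|exact: (cy Y)].
  have [B B0 BP] := (nbhs_ballP _ _).1 nXY.
  have BB t : `|t| < B -> ball (0 : R) B t.
    by rewrite -ball_normE /ball_ /= sub0r normrN.
  by exists B => // s t /BB/BP[Xs _] /BB/BP[_ Yt]; apply: (XY (y s, y t)).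
(* [C < B] puts pairs of times in the range of [BP]; [C <= A / 4] gives [|s + t| <= A / 2 < A], so
   the sum is still a time where [y] solves the equation. *)
pose C := Num.min (B / 2) (A / 2 / 2).
have C0 : 0 < C by rewrite lt_min !divr_gt0.
have CB : C < B by rewrite gt_min; apply/orP; left; lra.
have CA : C <= A / 2 / 2 by rewrite ge_min lexx orbT.
pose l t := cinv c (y t).
have yin t : `|t| < A -> in_chart (y t) by move=> /yP[/rP[]].
have lD s t : `|s| <= C -> `|t| <= C -> l (s + t) = (l s * l t)%g.
  move=> sC tC.
  (* As functions of t, both sides are integral curves starting at y s. *)
  have key : y (s + t) = mh (y s, y t).
    have K := uniq (fun t => y (s + t * 1)) (fun t => mh (y s, y t)) C C0.
    rewrite -{1}[t]mulr1; apply: K tC.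
    - lra.
    - rewrite mul0r addr0 y0 mh_e //; apply: yin; lra.
    - move=> u uC; have [|rsu dsu] := yP (s + u * 1).
        by rewrite mulr1; have := ler_normD s u; lra.
      by split=> //; rewrite -[F _ _]scale1r; exact: is_derive_line.
    - move=> u uC; have [[su _ _ _] Fsu rsu] :=
        BP s u (le_lt_trans sC CB) (le_lt_trans uC CB).
      split=> //; rewrite Fsu.
      have [d2 F2] := diff_partial2 (F (mu c) (y u))
        (smooth_at_differentiable su).
      have [|_ du] := yP u; first lra.
      by have := is_derive_comp du d2; rewrite F2.
  rewrite /l key; have [[_ _ _ /= dst] _ _] :=
    BP s t (le_lt_trans sC CB) (le_lt_trans tC CB).
  by rewrite /mh /= (cinvK cc).
have [g gD gl] := local_hom_extension lD C0.
have sl (t : R) : `|t| < A -> smooth_curve_at l t.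
  move=> tA; have [ydom yE] := yin t tA; split=> [|i d -> _ dd /= dl].
    apply: continuous_comp; first exact: (smooth_at_continuous (ys t tA)).
    by rewrite -yE; exact: cinv_continuous.
  apply: (smooth_at_comp (g := cmap d \o cinv c) (f := y : R^o -> _));
    last exact: ys.
  rewrite -[X in smooth_at _ X]yE; apply: smooth_at_transition; split=> //.
  exact: c1.1.
(* Smoothness is known only near 0; it spreads to [t] by left translation, as
   [g s = g t * l (s - t)] for [s] close to [t]. *)
have sg t : smooth_curve_at g t.
  have l0 : - t + t *: (1 : R^o) = 0 by rewrite /GRing.scale /= mulr1 addNr.
  have sh : smooth_curve_at (l \o (fun s : R^o => - t + s *: (1 : R^o))) t.
    apply: smooth_curve_at_reparam; first exact: smooth_at_line.
    by rewrite l0; exact: sl.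
  have := smooth_curve_at_comp sh (smooth1_at_lmul (g t) _).
  apply: smooth_curve_at_near_eq; near=> s => /=.
  rewrite -gl -?gD; last first.
    rewrite /GRing.scale /= mulr1 addrC -normrN opprB.
    by near: s; apply: cvgr_dist_le => //; exact: cvg_id.
  by rewrite /GRing.scale /= mulr1 addrA subrr add0r.
exists g; split=> //; first exact/smooth_curveP.
have g0c : charts_at (g 0) c by rewrite (hom0 gD); exact: c1.
have tv := velocity_tangent (sg 0); rewrite {1}(hom0 gD) in tv.
apply: (tangent_ext tv tmu c1).
rewrite (velocityE (sg 0) g0c).
have [dy yE] := is_derive_diff (yP 0 A00).2.
have n0 (K : R) : 0 < K -> \forall s \near (0 : R), `|s| < K.
  move=> K0; apply/nbhs_ballP; exists K => // s.
  by rewrite -ball_normE /ball_ /= sub0r normrN.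
have gy : \forall s \near (0 : R), y s = (cmap c \o g) s.
  near=> s; rewrite /= gl; last by apply: ltW; near: s; exact: n0.
  have sA : `|s| < A by near: s; exact: n0.
  by have [_ ->] := yin s sA.
apply: etrans (near_eq_diffE _ gy dy) _; rewrite yE y0.
(* It remains to see that the left invariant field takes the value [mu c] at [e], which follows from
   [mh (e, x) = x] near [e]. *)
have [d2 F2] := diff_partial2 (mu c) (smooth_at_differentiable smooth_mh).
apply: etrans (esym F2) _.
have ne : \forall x \near e, x = mh (e, x).
  by apply: filterS near_in_chart => x xc; rewrite mhe.
apply: etrans (near_eq_diffE _ ne (differentiable_id e)) _.
exact: diff_idE.
Unshelve. all: by end_near. Qed.

End LieGroupChart.

(** * Velocities of exponential curves *)

Section Exponential.
Context {R : realType} (H : lieGroupType R).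

Lemma velocity_scale (M : manifoldType R) (g : R -> M) (b : R) :
  smooth_curve_at g 0 -> velocity (fun s => g (s * b)) 0 = b *: velocity g 0.
Proof.
move=> sg.
have h0 : (fun s : R^o => 0 + s *: (b : R^o)) 0 = 0 by rewrite scale0r addr0.
have gE : (fun s => g (s * b)) = g \o (fun s : R^o => 0 + s *: (b : R^o)).
  by apply/funext => s; rewrite /= add0r.
have sgh : smooth_curve_at (fun s => g (s * b)) 0.
  rewrite gE; apply: smooth_curve_at_reparam; first exact: smooth_at_line.
  by rewrite h0.
have g0 : g (0 * b) = g 0 by rewrite mul0r.
have g0c := charts_at_chart_at (g 0).
have g0c' : charts_at (g (0 * b)) (chart_at (g 0)) by rewrite g0.
have t1 := velocity_tangent sgh; rewrite {1}g0 in t1.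
have t2 : tangent (g 0) (b *: velocity g 0).
  by rewrite -[X in tangent _ X]addr0; apply: tangentD;
    [exact: velocity_tangent|exact: tangent0].
apply: (tangent_ext t1 t2 g0c); rewrite (velocityE sgh g0c').
rewrite -[RHS]/(b *: velocity g 0 (chart_at (g 0))) (velocityE sg g0c).
have d := smooth_at_differentiable (smooth_curve_at_chart sg g0c).
have e0 : 0 + 0 * b = 0 by rewrite mul0r addr0.
have fE : (fun s : R => (cmap (chart_at (g 0)) \o g) (0 + s * b)) =
    cmap (chart_at (g 0)) \o (fun s => g (s * b)).
  by apply/funext => s; rewrite /= add0r.
have := diff_is_derive d erefl; rewrite -{1}e0 => /is_derive_line.
by rewrite fE => /is_derive_diff[_].
Qed.

(** The one-parameter subgroup of [t *: mu] is [s |-> g (s * t)]. Existence keeps [xget] from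
    returning its default, and uniqueness identifies what it returns; evaluation is at [s = 1]. *)
Lemma lie_exp_line (mu : tvec H) : tangent (1%g : H) mu ->
  exists2 g, one_parameter_subgroup mu g & forall t, lie_exp (t *: mu) = g t.
Proof.
move=> /one_parameter_subgroup_exists[g hg]; exists g => // t.
have [/smooth_curveP sg gD gmu] := hg.
have hgt : one_parameter_subgroup (t *: mu) (fun s => g (s * t)).
  split; last by rewrite velocity_scale // gmu.
    apply/smooth_curveP => s.
    have -> : (fun s => g (s * t)) = g \o (fun s : R^o => 0 + s *: (t : R^o)).
      by apply/funext => r; rewrite /= add0r.
    by apply: smooth_curve_at_reparam; [exact: smooth_at_line|exact: sg].
  by move=> r s; rewrite mulrDl gD.
rewrite /lie_exp.
have hx : one_parameter_subgroup (t *: mu)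
    (xget (fun=> 1%g) (one_parameter_subgroup (t *: mu))).
  by apply: xgetPex; exists (fun s => g (s * t)).
by rewrite (one_parameter_subgroup_unique hx hgt) mul1r.
Qed.

Lemma velocity_lie_exp (N : manifoldType R) (f : H -> N) (mu : tvec H) :
  smooth1_at f 1%g -> tangent (1%g : H) mu ->
  velocity (fun t : R => f (lie_exp (t *: mu))) 0 = tmap f 1%g mu.
Proof.
move=> sf /lie_exp_line[g [/smooth_curveP sg gD gmu] gE].
have -> : (fun t : R => f (lie_exp (t *: mu))) = f \o g.
  by apply/funext => t; rewrite /= gE.
by rewrite velocity_comp // (hom0 gD) // gmu.
Qed.

End Exponential.

(** * Smooth vector fields along maps *)

Section FieldAt.
Context {R : realType}.
Implicit Types M N K L : manifoldType R.

(** Pointwise version of [vector_field_along], meant for fields that are only given near [p].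
    Tangency is required on a neighbourhood since [tmapE] is applied at all points near [p]. *)
Definition field_at M N (f : M -> N) (X : M -> tvec N) (p : M) : Prop :=
  [/\ smooth1_at f p, \forall q \near p, tangent (f q) (X q) &
    forall c d, charts_at p c -> charts_at (f p) d ->
      smooth_at (fun x => X (cinv c x) d) (cmap c p)].

Lemma field_at_vector_field_along M N (f : M -> N) (X : M -> tvec N) :
  (forall p, field_at f X p) -> vector_field_along f X.
Proof.
move=> fX; split=> [p|c d cc cd].
  by have [_ tX _] := fX p; exact: (nbhs_singleton tX).
apply: smooth_at_smooth_on => _ [p [cp dfp] <-].
by have [_ _ sX] := fX p; exact: sX.
Qed.

Lemma smooth1_at_near_eq M N (f g : M -> N) p :
  (\forall q \near p, f q = g q) -> smooth1_at f p -> smooth1_at g p.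
Proof.
move=> fg [cf sf]; have fgp := nbhs_singleton fg.
split=> [|c d cc cp cd dgp].
  suff : g q @[q --> p] --> g p by [].
  by rewrite -fgp; apply: cvg_trans cf; exact: near_eq_cvg fg.
have dfp : dom d (f p) by rewrite fgp.
apply: smooth_at_near_eq (sf c d cc cp cd dfp).
have := near_chart (charts_is_chart cc) cp fg.
by apply: filterS => x /= ->.
Qed.

Lemma field_at_near_eq M N (f g : M -> N) (X Y : M -> tvec N) p :
  (\forall q \near p, f q = g q) -> (\forall q \near p, X q = Y q) ->
  field_at f X p -> field_at g Y p.
Proof.
move=> fg XY [sf tX sX]; split; first exact: smooth1_at_near_eq fg sf.
  near=> q; have <- : f q = g q by near: q.
  have <- : X q = Y q by near: q.
  by near: q.
move=> c d pc; rewrite -(nbhs_singleton fg) => fpd.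
apply: smooth_at_near_eq (sX c d pc fpd).
have := near_chart (charts_at_is_chart pc) pc.2 XY.
by apply: filterS => x /= ->.
Unshelve. all: by end_near. Qed.

Lemma field_atP M N (f : M -> N) (X Y : M -> tvec N) (a : R) p :
  field_at f X p -> field_at f Y p -> field_at f (fun q => a *: X q + Y q) p.
Proof.
move=> [sf tX sX] [_ tY sY]; split=> // [|c d pc fpd].
  by near=> q; apply: tangentD; near: q.
apply: smooth_atD; last exact: sY.
by apply: smooth_atZ; [exact: smooth_at_cst|exact: sX].
Unshelve. all: by end_near. Qed.

(** By definition [tmap] uses at [f q] the chart chosen there, with no regularity in [q]. Near [p],
    [tmapE] replaces it by one fixed chart, in which the field is a differential applied to a moving
    vector. *)
Lemma field_at_tmap M N K (f : M -> N) (g : N -> K) (X : M -> tvec N) p :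
  (\forall q \near f p, smooth1_at g q) -> field_at f X p ->
  field_at (g \o f) (fun q => tmap g (f q) (X q)) p.
Proof.
move=> sg [sf tX sX]; have sgp := nbhs_singleton sg.
have nsg : \forall q \near p, smooth1_at g (f q) by exact: (sf.1 _ sg).
split; first exact: smooth1_at_comp.
  near=> q; have sq : smooth1_at g (f q) by near: q.
  have tq : tangent (f q) (X q) by near: q.
  exact: (tmap_tangent sq tq).
move=> c e pc gfpe; have fpd := charts_at_chart_at (f p).
set d := chart_at (f p) in fpd.
have cK := cinvK (charts_at_is_chart pc) pc.2.
have S : smooth_at (fun x => 'd (cmap e \o g \o cinv d)
    ((cmap d \o f \o cinv c) x) (X (cinv c x) d)) (cmap c p).
  apply: smooth_at_diff; last exact: sX.
    by rewrite /= cK; exact: smooth1_at_chart.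
  exact: smooth1_at_chart.
apply: smooth_at_near_eq S.
have cgf := (smooth1_at_comp sf sgp).1.
have n1 : \forall x \near cmap c p, tangent (f (cinv c x)) (X (cinv c x)).
  exact: (near_chart (charts_at_is_chart pc) pc.2 tX).
have n2 : \forall x \near cmap c p, smooth1_at g (f (cinv c x)).
  exact: (near_chart (charts_at_is_chart pc) pc.2 nsg).
have n3 := near_charts_at sf.1 pc fpd.
have n4 := near_charts_at cgf pc gfpe.
near=> x; apply/esym.
have [_ xd] : charts_at (cinv c x) c /\ charts_at (f (cinv c x)) d by near: x.
have [_ xe] : charts_at (cinv c x) c /\ charts_at ((g \o f) (cinv c x)) e.
  by near: x.
have tx : tangent (f (cinv c x)) (X (cinv c x)) by near: x.
have sx : smooth1_at g (f (cinv c x)) by near: x.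
exact: (tmapE sx tx xd xe).
Unshelve. all: by end_near. Qed.

Lemma smooth2_at_chart M N K (F : M * N -> K) p q c d e :
  smooth2_at F (p, q) -> charts_at p c -> charts_at q d ->
  charts_at (F (p, q)) e ->
  smooth_at (cmap e \o F \o cinv (prod_chart c d)) (cmap c p, cmap d q).
Proof.
move=> [_ sF] [cc cp] [cd dq] [ce eF].
by apply: (sF (prod_chart c d) e) => //; exists c, d.
Qed.

Lemma tmap_partial1E M N K (F : M * N -> K) p q (v : tvec M) c d e :
  smooth2_at F (p, q) -> tangent p v -> charts_at p c -> charts_at q d ->
  charts_at (F (p, q)) e ->
  tmap (fun x => F (x, q)) p v e =
  'd (cmap e \o F \o cinv (prod_chart c d)) (cmap c p, cmap d q) (v c, 0).
Proof.
move=> sF tv pc qd Fe.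
have sF1 := smooth2_at_partial1 sF; rewrite (tmapE sF1 tv pc Fe).
have dF := smooth_at_differentiable (smooth2_at_chart sF pc qd Fe).
have [_ <-] := diff_partial1 (v c) dF.
suff -> : cmap e \o (fun x => F (x, q)) \o cinv c =
  (fun x => (cmap e \o F \o cinv (prod_chart c d)) (x, cmap d q)) by [].
by apply/funext => x /=; rewrite (cinvK (charts_at_is_chart qd)) //; case: qd.
Qed.

Lemma tmap_partial2E M N K (F : M * N -> K) p q (v : tvec N) c d e :
  smooth2_at F (p, q) -> tangent q v -> charts_at p c -> charts_at q d ->
  charts_at (F (p, q)) e ->
  tmap (fun y => F (p, y)) q v e =
  'd (cmap e \o F \o cinv (prod_chart c d)) (cmap c p, cmap d q) (0, v d).
Proof.
move=> sF tv pc qd Fe.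
have sF2 := smooth2_at_partial2 sF; rewrite (tmapE sF2 tv qd Fe).
have dF := smooth_at_differentiable (smooth2_at_chart sF pc qd Fe).
have [_ <-] := diff_partial2 (v d) dF.
suff -> : cmap e \o (fun y => F (p, y)) \o cinv d =
  (fun y => (cmap e \o F \o cinv (prod_chart c d)) (cmap c p, y)) by [].
by apply/funext => x /=; rewrite (cinvK (charts_at_is_chart pc)) //; case: pc.
Qed.

Lemma tmap_partialDE M N K (F : M * N -> K) p q (v : tvec M) (w : tvec N) c d e :
  smooth2_at F (p, q) -> tangent p v -> tangent q w ->
  charts_at p c -> charts_at q d -> charts_at (F (p, q)) e ->
  (tmap (fun x => F (x, q)) p v + tmap (fun y => F (p, y)) q w) e =
  'd (cmap e \o F \o cinv (prod_chart c d)) (cmap c p, cmap d q) (v c, w d).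
Proof.
move=> sF tv tw pc qd Fe; rewrite -[LHS]/(_ + _).
rewrite (tmap_partial1E sF tv pc qd Fe) (tmap_partial2E sF tw pc qd Fe) -linearD.
by congr ('d _ _ _); congr pair; rewrite ?addr0 ?add0r.
Qed.

Lemma tangent_sum M (p : M) (v w : tvec M) :
  tangent p v -> tangent p w -> tangent p (v + w).
Proof. by move=> tv tw; rewrite -[v]scale1r; exact: tangentD. Qed.

Lemma tangent_opp M (p : M) (v : tvec M) : tangent p v -> tangent p (- v).
Proof.
move=> tv; rewrite -scaleN1r -[_ *: v]addr0; exact: tangentD tv (tangent0 p).
Qed.

Lemma tmap_pair M N K L (F : M * N -> K) (f : L -> M) (g : L -> N) p
    (v : tvec L) :
  smooth1_at f p -> smooth1_at g p -> smooth2_at F (f p, g p) -> tangent p v ->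
  tmap (fun r => F (f r, g r)) p v =
  tmap (fun x => F (x, g p)) (f p) (tmap f p v) +
  tmap (fun y => F (f p, y)) (g p) (tmap g p v).
Proof.
move=> sf sg sF tv; have sFfg := smooth2_at_comp sf sg sF.
have [tfv tgv] := (tmap_tangent sf tv, tmap_tangent sg tv).
have pb := charts_at_chart_at p; set b := chart_at p in pb.
have fpc := charts_at_chart_at (f p); set c := chart_at (f p) in fpc.
have gpd := charts_at_chart_at (g p); set d := chart_at (g p) in gpd.
have Fe := charts_at_chart_at (F (f p, g p)); set e := chart_at _ in Fe.
have t1 := tmap_tangent (smooth2_at_partial1 sF) tfv.
have t2 := tmap_tangent (smooth2_at_partial2 sF) tgv.
apply: (tangent_ext (tmap_tangent sFfg tv) (tangent_sum t1 t2) Fe).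
rewrite (tmap_partialDE sF tfv tgv fpc gpd Fe) (tmapE sFfg tv pb Fe).
rewrite (tmapE sf tv pb fpc) (tmapE sg tv pb gpd).
have df := smooth_at_differentiable (smooth1_at_chart sf pb fpc).
have dg := smooth_at_differentiable (smooth1_at_chart sg pb gpd).
have dF := smooth_at_differentiable (smooth2_at_chart sF fpc gpd Fe).
rewrite -(diff_pairE _ df dg).
apply: (diff_comp_near _ _ (differentiable_pair df dg) dF).
  by rewrite /= (cinvK (charts_at_is_chart pb)) //; case: pb.
have n1 := near_charts_at sf.1 pb fpc; have n2 := near_charts_at sg.1 pb gpd.
near=> x.
have [_ [_ xc]] : charts_at (cinv b x) b /\ charts_at (f (cinv b x)) c by near: x.
have [_ [_ xd]] : charts_at (cinv b x) b /\ charts_at (g (cinv b x)) d by near: x.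
rewrite /= (cinvK (charts_at_is_chart fpc)) //.
by rewrite (cinvK (charts_at_is_chart gpd)).
Unshelve. all: by end_near. Qed.

(** In product charts the two partial tangent maps add up to the full differential of [F] on the
    pair of components, so [smooth_at_diff] applies once more. *)
Lemma field_at_pair M N K L (F : M * N -> K) (f : L -> M) (g : L -> N)
    (X : L -> tvec M) (Y : L -> tvec N) p :
  (\forall z \near (f p, g p), smooth2_at F z) ->
  field_at f X p -> field_at g Y p ->
  field_at (fun r => F (f r, g r))
    (fun r => tmap (fun x => F (x, g r)) (f r) (X r) +
              tmap (fun y => F (f r, y)) (g r) (Y r)) p.
Proof.
move=> sF [sf tX sX] [sg tY sY]; have sFp := nbhs_singleton sF.
have sFfg := smooth2_at_comp sf sg sFp.
have nsF : \forall q \near p, smooth2_at F (f q, g q).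
  have := cvg_pair sf.1 sg.1; apply; exact: sF.
split=> //.
  near=> q; have sq : smooth2_at F (f q, g q) by near: q.
  have Xq : tangent (f q) (X q) by near: q.
  have Yq : tangent (g q) (Y q) by near: q.
  have t1 := tmap_tangent (smooth2_at_partial1 sq) Xq.
  exact: tangent_sum t1 (tmap_tangent (smooth2_at_partial2 sq) Yq).
move=> b e pb Fe.
have fpc := charts_at_chart_at (f p); set c := chart_at (f p) in fpc.
have gpd := charts_at_chart_at (g p); set d := chart_at (g p) in gpd.
have bK := cinvK (charts_at_is_chart pb) pb.2.
have S : smooth_at (fun x => 'd (cmap e \o F \o cinv (prod_chart c d))
    ((cmap c \o f \o cinv b) x, (cmap d \o g \o cinv b) x)
    (X (cinv b x) c, Y (cinv b x) d)) (cmap b p).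
  apply: (smooth_at_diff (f := fun x => ((cmap c \o f \o cinv b) x,
    (cmap d \o g \o cinv b) x)) (w := fun x => (X (cinv b x) c, Y (cinv b x) d))).
  - by rewrite /= bK; exact: smooth2_at_chart.
  - by apply: smooth_at_pair; exact: smooth1_at_chart.
  - by apply: smooth_at_pair; [exact: sX|exact: sY].
apply: smooth_at_near_eq S.
have pbc := charts_at_is_chart pb.
have n1 := near_chart pbc pb.2 tX; have n2 := near_chart pbc pb.2 tY.
have n3 := near_chart pbc pb.2 nsF.
have n4 := near_charts_at sf.1 pb fpc; have n5 := near_charts_at sg.1 pb gpd.
have n6 := near_charts_at sFfg.1 pb Fe.
near=> x; apply/esym.
have [_ xc] : charts_at (cinv b x) b /\ charts_at (f (cinv b x)) c by near: x.
have [_ xd] : charts_at (cinv b x) b /\ charts_at (g (cinv b x)) d by near: x.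
have [_ xe] : charts_at (cinv b x) b /\
  charts_at (F (f (cinv b x), g (cinv b x))) e by near: x.
have Xx : tangent (f (cinv b x)) (X (cinv b x)) by near: x.
have Yx : tangent (g (cinv b x)) (Y (cinv b x)) by near: x.
have sx : smooth2_at F (f (cinv b x), g (cinv b x)) by near: x.
exact: (tmap_partialDE sx Xx Yx xc xd xe).
Unshelve. all: by end_near. Qed.

Lemma field_at0 M N (f : M -> N) p : smooth1_at f p -> field_at f (fun=> 0) p.
Proof.
move=> sf; split=> // [|c d _ _]; last exact: smooth_at_cst.
by apply: nearW => q; exact: tangent0.
Qed.

(** The case of a zero second field. The parameter [g r] still moves with [r], as it does for
    horizontal lifts. *)
Lemma field_at_partial1 M N K L (F : M * N -> K) (f : L -> M) (g : L -> N)
    (X : L -> tvec M) p :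
  (\forall z \near (f p, g p), smooth2_at F z) ->
  field_at f X p -> smooth1_at g p ->
  field_at (fun r => F (f r, g r))
    (fun r => tmap (fun x => F (x, g r)) (f r) (X r)) p.
Proof.
move=> sF fX sg; have := field_at_pair sF fX (field_at0 sg).
by apply: field_at_near_eq; apply: nearW => q //; rewrite tmap0 addr0.
Qed.

Lemma field_at_partial2 M N K L (F : M * N -> K) (f : L -> M) (g : L -> N)
    (Y : L -> tvec N) p :
  (\forall z \near (f p, g p), smooth2_at F z) ->
  smooth1_at f p -> field_at g Y p ->
  field_at (fun r => F (f r, g r))
    (fun r => tmap (fun y => F (f r, y)) (g r) (Y r)) p.
Proof.
move=> sF sf gY; have := field_at_pair sF (field_at0 sf) gY.
by apply: field_at_near_eq; apply: nearW => q //; rewrite tmap0 add0r.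
Qed.

Lemma vector_field_field_at M (X : M -> tvec M) p :
  vector_field X -> field_at idfun X p.
Proof.
move=> [tX sX].
split; [exact: smooth1_at_id|exact: nearW|move=> c d [cc cp] [cd dp]].
have /smooth_onE H := sX c d cc cd; apply: (filterS H).
have ccc := charts_is_chart cc; near=> x.
have [_ <-] : dom c (cinv c x) /\ cmap c (cinv c x) = x.
  by near: x; exact: (near_cinv ccc cp).
exists (cinv c x) => //; near: x.
apply: (near_chart ccc cp (P := dom c `&` dom d)).
by apply: filterI; apply: near_dom => //; exact: charts_is_chart.
Unshelve. all: by end_near. Qed.

Lemma field_at_pullback M N K (f : M -> N) (g : N -> K) (X : N -> tvec K) p :
  smooth1_at f p -> field_at g X (f p) -> field_at (g \o f) (X \o f) p.
Proof.
move=> sf [sg tX sX]; split; first exact: smooth1_at_comp.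
  exact: (sf.1 _ tX).
move=> c e pc gfpe; have fpd := charts_at_chart_at (f p).
set d := chart_at (f p) in fpd.
have cK := cinvK (charts_at_is_chart pc) pc.2.
have S : smooth_at ((fun y => X (cinv d y) e) \o (cmap d \o f \o cinv c))
    (cmap c p).
  apply: smooth_at_comp; last exact: smooth1_at_chart.
  by rewrite /= cK; exact: sX.
apply: smooth_at_near_eq S.
have n1 := near_charts_at sf.1 pc fpd.
apply: filterS n1 => x [_ [cd xd]] /=.
by rewrite (cinvK (charts_is_chart cd)).
Qed.

End FieldAt.

Section LinearFields.
Context {R : realType}.
Implicit Types M N L : manifoldType R.

Lemma linear_rV_continuous n (W : normedModType R) (f : {linear 'rV[R]_n -> W}) :
  continuous f.
Proof.
have -> : f = \sum_i (fun x : 'rV[R]_n => x ord0 i *: f (delta_mx ord0 i))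
    :> ('rV[R]_n -> W).
  apply/funext => x; rewrite {1}[x]row_sum_delta linear_sum fct_sumE.
  by apply: eq_bigr => i _; rewrite linearZ.
elim/big_ind : _ => [x|g h cg ch x|i _ x].
- exact: (@cst_continuous _ _ (0 : W)).
- by apply: continuousD; [exact: cg|exact: ch].
- by apply: continuousZr_tmp; exact: coord_continuous.
Qed.

(** Inverse of the coordinate isomorphism [v |-> v c] from the tangent space at [p], when [c] is a
    chart around [p]. *)
Definition tangent_lift M (p : M) (c : chart M 'rV[R]_(@mdim R M))
    (x : 'rV[R]_(@mdim R M)) : tvec M :=
  fun d => if `[< charts_at p d >] then 'd (cmap d \o cinv c) (cmap c p) x else 0.

Lemma tangent_liftK M (p : M) c (v : tvec M) :
  charts_at p c -> tangent p v -> tangent_lift p c (v c) = v.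
Proof.
move=> pc tv; apply/funext => d; rewrite /tangent_lift; case: asboolP => pd.
  by rewrite [RHS](tangent_transition tv pc pd).
by rewrite tv.2.
Qed.

Lemma tangent_lift_tangent M (p : M) c x :
  charts_at p c -> tangent p (tangent_lift p c x).
Proof.
move=> pc; split=> [d e pd pe|d npd]; last by rewrite /tangent_lift asboolF.
rewrite /tangent_lift !asboolT //.
have d1 := smooth_at_differentiable (smooth_at_transition pc pd).
have d2 := smooth_at_differentiable (smooth_at_transition pd pe).
apply: (diff_comp_near _ _ d1 d2).
  by rewrite /= (cinvK (charts_at_is_chart pc)) //; case: pc.
have n1 := near_charts_at (@cvg_id _ _) pc pd.
apply: filterS n1 => y [_ [cd yd]] /=.
by rewrite (cinvK (charts_is_chart cd)).
Qed.

Lemma tangent_liftP M (p : M) c a x y :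
  tangent_lift p c (a *: x + y) = a *: tangent_lift p c x + tangent_lift p c y.
Proof.
apply/funext => d; rewrite -[RHS]/(_ *: tangent_lift p c x d + _) /tangent_lift.
by case: asboolP => _; [rewrite linearP|rewrite scaler0 addr0].
Qed.

(** [alpha] is linear only on the tangent space at [a]. Composed with [tangent_lift] it becomes a
    linear map between row vectors, hence continuous, and preserves smoothness. *)
Lemma field_at_linear L M N (a : M) (b : N) (alpha : tvec M -> tvec N)
    (X : L -> tvec M) p :
  (forall v, tangent a v -> tangent b (alpha v)) ->
  (forall k v w, tangent a v -> tangent a w ->
     alpha (k *: v + w) = k *: alpha v + alpha w) ->
  field_at (fun=> a) X p -> field_at (fun=> b) (alpha \o X) p.
Proof.
move=> talpha lalpha [_ tX sX]; split; first exact: smooth1_at_cst.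
  by apply: filterS tX => q; exact: talpha.
move=> c d pc bd; have ac0 := charts_at_chart_at a; set c0 := chart_at a in ac0.
pose l x := alpha (tangent_lift a c0 x) d.
have ll : linear l.
  move=> k x y; rewrite /l tangent_liftP lalpha //; exact: tangent_lift_tangent.
pose lM := GRing.isLinear.Build _ _ _ _ _ ll.
pose lL : {linear 'rV[R]_(@mdim R M) -> 'rV[R]_(@mdim R N)} := HB.pack l lM.
have S := smooth_at_linear_comp (@linear_rV_continuous _ _ lL) (sX c c0 pc ac0).
apply: smooth_at_near_eq S.
have := near_chart (charts_at_is_chart pc) pc.2 tX.
by apply: filterS => x tx; rewrite /= /l tangent_liftK.
Qed.

End LinearFields.

Section DirectSum.
Context {R : realType} {V : lmodType R}.
Implicit Types A B C : set V.

Lemma linear_subspace0 A : linear_subspace A -> A 0.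
Proof. by move=> [A0 _]; have := A0; rewrite inE. Qed.

Lemma linear_subspaceP A a u v :
  linear_subspace A -> A u -> A v -> A (a *: u + v).
Proof.
move=> [_ Aacc] Au Av.
by have := Aacc a u v; rewrite !inE; apply.
Qed.

Lemma linear_subspaceB A u v : linear_subspace A -> A u -> A v -> A (u - v).
Proof.
by move=> lA Au Av; rewrite addrC -scaleN1r; exact: linear_subspaceP.
Qed.

Lemma linear_subspaceI A :
  A 0 -> (forall a u v, A u -> A v -> A (a *: u + v)) -> linear_subspace A.
Proof.
move=> A0 Aacc; split=> [|a u v]; rewrite !inE //; exact: Aacc.
Qed.

Lemma direct_sum_sub2 C A B : direct_sum C A B -> B `<=` C.
Proof.
move=> [lA _ -> _] b Bb; exists 0; first exact: linear_subspace0.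
by exists b => //; rewrite add0r.
Qed.

Lemma direct_sum_unique C A B a a' b b' : direct_sum C A B ->
  A a -> A a' -> B b -> B b' -> a + b = a' + b' -> a = a' /\ b = b'.
Proof.
move=> [lA lB _ AB0] Aa Aa' Bb Bb' E.
have E' : a - a' = b' - b.
  by apply/eqP; rewrite subr_eq addrAC eq_sym subr_eq addrC E addrC.
have : (A `&` B) (a - a').
  by split; [exact: linear_subspaceB|rewrite E'; exact: linear_subspaceB].
rewrite AB0 => /eqP; rewrite subr_eq0 => /eqP aa'; split=> //.
by move: E; rewrite aa' => /addrI.
Qed.

End DirectSum.

(** * Principal bundles and reductive structures *)

Section BundleTangent.
Context {R : realType} (M Q : manifoldType R) (H : lieGroupType R).
Variable b : principal_bundle M Q H.

Lemma smooth2_at_act (z : Q * H) :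
  smooth2_at (fun p : Q * H => act b p.1 p.2) z.
Proof. by apply: (smooth2_smooth2_at openT I); exact: smooth_act. Qed.

Lemma smooth1_at_orbit (q : Q) (a : H) : smooth1_at (act b q) a.
Proof. exact: (smooth2_at_partial2 (smooth2_at_act (q, a))). Qed.

Lemma smooth1_at_ract (a : H) (q : Q) : smooth1_at (fun r => act b r a) q.
Proof. exact: (smooth2_at_partial1 (smooth2_at_act (q, a))). Qed.

Lemma smooth1_at_proj (q : Q) : smooth1_at (Defs.proj b) q.
Proof. by apply: (smooth_smooth1_at openT I); exact: smooth_proj. Qed.

Lemma tmap_proj_orbit q (eta : tvec H) : tangent (1%g : H) eta ->
  tmap (Defs.proj b) q (tmap (act b q) 1%g eta) = 0.
Proof.
(* Only the base point of the outer tangent map is rewritten as [act b q 1], the form in which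
   [tmap_comp] expects it; the [q] of the orbit map must stay. *)
move=> teta; have /(congr1 (fun r => tmap (Defs.proj b) r)) E := act1 b q.
rewrite -E -tmap_comp //; [|exact: smooth1_at_orbit|exact: smooth1_at_proj].
suff -> : Defs.proj b \o act b q = fun=> Defs.proj b q by rewrite tmap_cst.
by apply/funext => a; exact: proj_act.
Qed.

(* The local trivialization is (proj b, k), with inverse [s]. *)
Definition trivializes (U : set M) (k : Q -> H) (s : M * H -> Q) : Prop :=
  [/\ open U, (forall q, U (Defs.proj b q) -> smooth1_at k q),
      (forall y h, U y -> smooth2_at s (y, h)),
      (forall q a, U (Defs.proj b q) -> k (act b q a) = (k q * a)%g) &
      (forall q, U (Defs.proj b q) -> s (Defs.proj b q, k q) = q) /\
      (forall y h, U y -> Defs.proj b (s (y, h)) = y /\ k (s (y, h)) = h)].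

Lemma trivialization (x : M) :
  exists (U : set M) k s, U x /\ trivializes U k s.
Proof.
have [U [k [s [[oU Ux] [sk ss] kact sK Ks]]]] := locally_trivial b x.
have cproj : continuous (Defs.proj b) by move=> q; have [] := smooth1_at_proj q.
have oU' : open (Defs.proj b @^-1` U) by apply: open_comp => // q _; exact: cproj.
have oUH : open (U `*` [set: H]).
  rewrite openE => -[y h] [/= Uy _]; exists (U, setT) => //.
  by split; [exact: open_nbhs_nbhs|exact: filterT].
exists U, k, s; split=> //; split=> // [q Uq|y h Uy].
  exact: (smooth_smooth1_at oU' Uq sk).
by apply: (smooth2_smooth2_at oUH _ ss).
Qed.

Section Trivialized.
Variables (U : set M) (k : Q -> H) (s : M * H -> Q).
Hypothesis triv : trivializes U k s.

Lemma near_trivialized q :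
  U (Defs.proj b q) -> \forall r \near q, U (Defs.proj b r).
Proof.
have [oU _ _ _ _] := triv; move=> Uq; apply: (smooth1_at_proj q).1.
exact: open_nbhs_nbhs.
Qed.

(* The flat connection form of the trivialization. *)
Definition vertical_part (q : Q) (w : tvec Q) : tvec H :=
  tmap (fun r => ((k q)^-1 * k r)%g) q w.

(** The lift tangent to the slice through [q] on which [k] is constant, that is, horizontal for the
    same flat connection. *)
Definition horizontal_lift (q : Q) (v : tvec M) : tvec Q :=
  tmap (fun y => s (y, k q)) (Defs.proj b q) v.

Let smooth_vp q : U (Defs.proj b q) -> smooth1_at (fun r => ((k q)^-1 * k r)%g) q.
Proof.
have [_ sk _ _ _] := triv; move=> /sk skq.
exact: smooth1_at_comp skq (smooth1_at_lmul _ _).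
Qed.

Lemma vertical_part_tangent q w : U (Defs.proj b q) -> tangent q w ->
  tangent (1%g : H) (vertical_part q w).
Proof.
by move=> Uq tw; have := tmap_tangent (smooth_vp Uq) tw; rewrite mulVg.
Qed.

Lemma horizontal_lift_tangent q v :
  U (Defs.proj b q) -> tangent (Defs.proj b q) v ->
  tangent q (horizontal_lift q v).
Proof.
have [_ _ ss _ [sK _]] := triv; move=> Uq tv.
have := tmap_tangent (smooth2_at_partial1 (ss _ (k q) Uq)) tv.
by rewrite sK.
Qed.

Lemma tmap_proj_horizontal_lift q v :
  U (Defs.proj b q) -> tangent (Defs.proj b q) v ->
  tmap (Defs.proj b) q (horizontal_lift q v) = v.
Proof.
have [oU _ ss _ [sK Ks]] := triv; move=> Uq tv.
have /(congr1 (fun r => tmap (Defs.proj b) r)) E := sK q Uq.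
have ss1 := smooth2_at_partial1 (ss _ (k q) Uq).
rewrite -E -tmap_comp //; last exact: smooth1_at_proj.
rewrite -[RHS](tmap_id tv).
apply: tmap_near_eq; last exact: smooth1_at_id.
apply: filterS (open_nbhs_nbhs (conj oU Uq)) => y Uy.
by have [/= -> _] := Ks y (k q) Uy.
Qed.

(** Equivariance of [k] gives [(k q)^-1 * k (act b q a) = a], whose derivative at 1 is the claim. *)
Lemma vertical_part_orbit q eta : U (Defs.proj b q) -> tangent (1%g : H) eta ->
  vertical_part q (tmap (act b q) 1%g eta) = eta.
Proof.
have [_ _ _ kact _] := triv; move=> Uq teta.
rewrite /vertical_part.
have /(congr1 (fun r => tmap (fun r => ((k q)^-1 * k r)%g) r)) E := act1 b q.
rewrite -E -tmap_comp //; [|exact: smooth1_at_orbit|]; last first.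
  by rewrite act1; exact: smooth_vp.
rewrite -[RHS](tmap_id teta); congr (tmap _ _ _).
by apply/funext => a; rewrite /= kact // mulKg.
Qed.

(* On a fibre, the trivialization identifies the orbit map with a left
   translation of [H]. *)
Lemma vertical_partK q w : U (Defs.proj b q) -> tangent q w ->
  tmap (Defs.proj b) q w = 0 -> tmap (act b q) 1%g (vertical_part q w) = w.
Proof.
have [oU sk ss kact [sK Ks]] := triv; move=> Uq tw pw0.
have skq := sk q Uq.
have orbE : act b q \o (fun r => ((k q)^-1 * k r)%g) =
    fun r => s (Defs.proj b q, k r).
  apply/funext => r; rewrite /=; set a := ((k q)^-1 * k r)%g.
  have -> : k r = k (act b q a) by rewrite kact // /a mulVKg.
  have Ua : U (Defs.proj b (act b q a)) by rewrite proj_act.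
  by have := sK _ Ua; rewrite proj_act => ->.
have /(congr1 (fun h => tmap (act b q) h)) E := mulVg (k q).
apply: etrans (congr1 (fun f => f (vertical_part q w)) (esym E)) _.
apply: etrans (esym (tmap_comp (smooth_vp Uq) (smooth1_at_orbit _ _) tw)) _.
rewrite orbE -[RHS](tmap_id tw).
have sqq : smooth2_at s (Defs.proj b q, k q) by exact: ss.
(* The map [r |-> s (proj r, k r)] is the identity near [q]. As [w] is vertical, only its dependence
   on [k r] contributes to the tangent map at [w]. *)
have L := tmap_pair (smooth1_at_proj q) skq sqq tw.
rewrite pw0 tmap0 add0r in L.
have sK' : \forall r \near q, s (Defs.proj b r, k r) = idfun r.
  by apply: filterS (near_trivialized Uq) => r Ur; rewrite sK.
have E2 := tmap_near_eq w sK' (smooth2_at_comp (smooth1_at_proj q) skq sqq).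
apply: etrans _ (esym E2); rewrite L.
exact: (tmap_comp skq (smooth2_at_partial2 sqq) tw).
Qed.

End Trivialized.

Lemma tmap_orbit_inj q (eta : tvec H) : tangent (1%g : H) eta ->
  tmap (act b q) 1%g eta = 0 -> eta = 0.
Proof.
move=> teta e0; have [U [k [s [Uq triv]]]] := trivialization (Defs.proj b q).
by rewrite -(vertical_part_orbit triv Uq teta) e0 /vertical_part tmap0.
Qed.

Lemma vertical_orbit q w : tangent q w -> tmap (Defs.proj b) q w = 0 ->
  exists2 eta, tangent (1%g : H) eta & w = tmap (act b q) 1%g eta.
Proof.
move=> tw pw0; have [U [k [s [Uq triv]]]] := trivialization (Defs.proj b q).
exists (vertical_part k q w); first exact: (vertical_part_tangent triv).
by rewrite (vertical_partK triv).
Qed.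

End BundleTangent.

Lemma near_pairW (T T' : topologicalType) (a : T) (b : T') (A : set (T * T')) :
  (forall z, A z) -> \forall z \near (a, b), A z.
Proof.
by move=> AT; exists (setT, setT); [split; exact: filterT|move=> z _; exact: AT].
Qed.

(** * The canonical decomposition and the splitting of a field *)

Section ReductiveStructure.
Context {R : realType} (M P Q : manifoldType R) (G H : lieGroupType R).
Variables (bP : principal_bundle M P G) (bQ : principal_bundle M Q H).
Variables (j : G -> H) (i : P -> Q) (m : set (tvec H)).
Hypothesis hred : reductive_structure bP bQ j i m.

Let smooth_j a : smooth1_at j a.
Proof.
by have [[_ [sj _ _]] _ _] := hred; exact: (smooth_smooth1_at openT I sj).
Qed.

Let smooth_i u : smooth1_at i u.
Proof.
by have [_ [[si _ _] _ _] _] := hred; exact: (smooth_smooth1_at openT I si).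
Qed.

Let j1 : j 1%g = 1%g.
Proof.
by have [[jM _] _ _] := hred; apply: (@mulgI _ (j 1%g)); rewrite -jM !mulg1.
Qed.

Let jV a : j (a^-1)%g = (j a)^-1%g.
Proof.
have [[jM _] _ _] := hred; apply: (@mulgI _ (j a)).
by rewrite -jM !mulgV j1.
Qed.

Let iM u a : i (act bP u a) = act bQ (i u) (j a).
Proof. by have [_ [_ iact _] _] := hred; exact: iact. Qed.

Let proj_i u : Defs.proj bQ (i u) = Defs.proj bP u.
Proof. by have [_ [_ _ pi] _] := hred; exact: pi. Qed.

Let tmap_j_inj v : tangent (1%g : G) v -> tmap j 1%g v = 0 -> v = 0.
Proof. by have [[_ [_ _ ij]] _ _] := hred; exact: ij. Qed.

Let tmap_i_inj u v : tangent u v -> tmap i u v = 0 -> v = 0.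
Proof. by have [_ [[_ _ ii] _ _] _] := hred; exact: ii. Qed.

Let tangent_j xi : tangent (1%g : G) xi -> tangent (1%g : H) (tmap j 1%g xi).
Proof. by move=> txi; rewrite -j1; exact: tmap_tangent. Qed.

Let hsum : direct_sum (@lie_algebra R H) (lie_subalgebra j) m.
Proof. by have [_ _ []] := hred. Qed.

Let m_tangent mu : m mu -> tangent (1%g : H) mu.
Proof. exact: (direct_sum_sub2 hsum). Qed.

(** The derivative at 1 of [i (act bP u a) = act bQ (i u) (j a)]: fundamental vectors of [P] are
    sent to fundamental vectors of [Q]. *)
Lemma tmap_orbit_subbundle u xi : tangent (1%g : G) xi ->
  tmap (act bQ (i u)) 1%g (tmap j 1%g xi) = tmap i u (tmap (act bP u) 1%g xi).
Proof.
move=> txi.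
have -> : tmap i u = tmap i (act bP u 1%g) by rewrite act1.
have -> : tmap (act bQ (i u)) 1%g = tmap (act bQ (i u)) (j 1%g) by rewrite j1.
apply: etrans (esym (tmap_comp (smooth_j _) (smooth1_at_orbit _ _ _) txi)) _.
apply: etrans (tmap_comp (smooth1_at_orbit _ _ _) (smooth_i _) txi).
have -> : act bQ (i u) \o j = i \o act bP u by apply/funext => a; rewrite /= iM.
reflexivity.
Qed.

(** Replaces exponential curves by the differential of the orbit map, which is linear and for which
    smoothness in [u] is available. *)
Lemma transverse_fibreE u :
  transverse_fibre bQ i m u = tmap (act bQ (i u)) 1%g @` m.
Proof.
by apply/seteqP; split=> _ [mu mmu <-]; exists mu => //;
  rewrite velocity_lie_exp //; [exact: smooth1_at_orbit|exact: m_tangent|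
  exact: smooth1_at_orbit|exact: m_tangent].
Qed.

Lemma tmap_proj_i u v : tangent u v ->
  tmap (Defs.proj bQ) (i u) (tmap i u v) = tmap (Defs.proj bP) u v.
Proof.
move=> tv.
apply: etrans (esym (tmap_comp (smooth_i _) (smooth1_at_proj _ _) tv)) _.
have -> : Defs.proj bQ \o i = Defs.proj bP by apply/funext => r; exact: proj_i.
reflexivity.
Qed.

(** The components are picked by choice; uniqueness of the decomposition and injectivity of the
    differential of [j] make them linear. [alpha] takes values in the Lie algebra of [G] itself, not
    in its image, so that orbit maps of [P] can be applied to it. *)
Lemma reductive_splitting : exists (alpha : tvec H -> tvec G)
    (beta : tvec H -> tvec H),
  [/\ (forall v, tangent (1%g : H) v ->
        [/\ tangent (1%g : G) (alpha v), m (beta v) &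
            v = tmap j 1%g (alpha v) + beta v]),
      (forall a v w, tangent (1%g : H) v -> tangent (1%g : H) w ->
        alpha (a *: v + w) = a *: alpha v + alpha w) &
      (forall a v w, tangent (1%g : H) v -> tangent (1%g : H) w ->
        beta (a *: v + w) = a *: beta v + beta w)].
Proof.
have [lj lm hE _] := hsum.
have /choice[ab abP] v : exists p : tvec G * tvec H, tangent (1%g : H) v ->
    [/\ tangent (1%g : G) p.1, m p.2 & v = tmap j 1%g p.1 + p.2].
  have [tv|ntv] := pselect (tangent (1%g : H) v); last by exists (0, 0).
  have : [set a + b | a in lie_subalgebra j & b in m] v by rewrite -hE.
  by move=> [_ [xi txi <-] [mu mmu <-]]; exists (xi, mu).
have lin a v w : tangent (1%g : H) v -> tangent (1%g : H) w ->
    (ab (a *: v + w)).1 = a *: (ab v).1 + (ab w).1 /\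
    (ab (a *: v + w)).2 = a *: (ab v).2 + (ab w).2.
  move=> tv tw; have [xv mv vE] := abP v tv; have [xw mw wE] := abP w tw.
  have [xa ma aE] := abP _ (tangentD a tv tw).
  have txvw := tangentD a xv xw.
  have E : tmap j 1%g (ab (a *: v + w)).1 + (ab (a *: v + w)).2 =
      tmap j 1%g (a *: (ab v).1 + (ab w).1) + (a *: (ab v).2 + (ab w).2).
    by rewrite -aE tmapP [in LHS]vE [in LHS]wE scalerDr addrACA.
  have [E1 E2] := direct_sum_unique hsum
    (ex_intro2 _ _ _ xa erefl) (ex_intro2 _ _ _ txvw erefl) ma
    (linear_subspaceP a lm mv mw) E.
  split=> //; apply/eqP; rewrite -subr_eq0; apply/eqP/tmap_j_inj.
    exact: tangent_sum xa (tangent_opp txvw).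
  by rewrite tmapB E1 subrr.
exists (fun v => (ab v).1), (fun v => (ab v).2).
split=> [v tv|a v w tv tw|a v w tv tw].
- exact: abP.
- by have [] := lin a v w tv tw.
- by have [] := lin a v w tv tw.
Qed.

(** The common vector is vertical, so [v] comes from some [xi] in the Lie algebra of [G].
    Injectivity of the orbit differential in [Q] identifies the image of [xi] with [mu], which then
    lies in both summands. *)
Lemma kosmann_inter u v mu : tangent u v -> m mu ->
  tmap i u v = tmap (act bQ (i u)) 1%g mu -> v = 0 /\ mu = 0.
Proof.
move=> tv mmu E; have tmu := m_tangent mmu.
have pv0 : tmap (Defs.proj bP) u v = 0.
  by rewrite -tmap_proj_i // E tmap_proj_orbit.
have [xi txi vE] := vertical_orbit tv pv0.
have xmu : tmap j 1%g xi = mu.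
  apply/eqP; rewrite -subr_eq0; apply/eqP/(tmap_orbit_inj (b := bQ) (q := i u)).
    exact: tangent_sum (tangent_j txi) (tangent_opp tmu).
  by rewrite tmapB tmap_orbit_subbundle // -vE E subrr.
have [_ _ _ inter] := hsum.
have mu0 : mu = 0.
  have : (lie_subalgebra j `&` m) mu by split=> //; exists xi.
  by rewrite inter.
split=> //; have xi0 : xi = 0 by apply: tmap_j_inj => //; rewrite xmu.
by rewrite vE xi0 tmap0.
Qed.

(** Besides existence of the decomposition at [u], this gives an expression valid for all nearby [u]
    with the same trivializations, from which smoothness is read. *)
Lemma kosmann_formula (alpha : tvec H -> tvec G) (beta : tvec H -> tvec H)
    U k s U' k' s' u (w : tvec Q) :
  trivializes bQ U k s -> trivializes bP U' k' s' ->
  U (Defs.proj bP u) -> U' (Defs.proj bP u) -> tangent (i u) w ->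
  (forall v, tangent (1%g : H) v ->
        [/\ tangent (1%g : G) (alpha v), m (beta v) &
            v = tmap j 1%g (alpha v) + beta v]) ->
  let h := horizontal_lift bP k' s' u (tmap (Defs.proj bQ) (i u) w) in
  let eta := vertical_part k (i u) (w - tmap i u h) in
  [/\ tangent u h, tangent (1%g : H) eta &
    w = tmap i u (h + tmap (act bP u) 1%g (alpha eta)) +
        tmap (act bQ (i u)) 1%g (beta eta)].
Proof.
move=> triv triv' Uu U'u tw splitP h eta.
have tpw : tangent (Defs.proj bP u) (tmap (Defs.proj bQ) (i u) w).
  by rewrite -proj_i; apply: tmap_tangent => //; exact: smooth1_at_proj.
have th : tangent u h := horizontal_lift_tangent triv' U'u tpw.
have tw' : tangent (i u) (w - tmap i u h).
  by apply: tangent_sum => //; apply: tangent_opp; exact: tmap_tangent.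
have Ui : U (Defs.proj bQ (i u)) by rewrite proj_i.
have teta : tangent (1%g : H) eta := vertical_part_tangent triv Ui tw'.
split=> //; have [ta mb etaE] := splitP eta teta.
have w'E : tmap (act bQ (i u)) 1%g eta = w - tmap i u h.
  apply: (vertical_partK triv Ui tw').
  rewrite tmapB tmap_proj_i // (tmap_proj_horizontal_lift triv') //.
  by rewrite subrr.
rewrite tmapD -addrA -tmap_orbit_subbundle // -tmapD -etaE w'E.
by rewrite addrC subrK.
Qed.

Lemma reductive_canonical_decomposition u : canonical_decomposition bQ i m u.
Proof.
have [alpha [beta [splitP _ _]]] := reductive_splitting.
have [U [k [s [Uu triv]]]] := trivialization bQ (Defs.proj bP u).
have [U' [k' [s' [U'u triv']]]] := trivialization bP (Defs.proj bP u).
have [_ lm _ _] := hsum; rewrite /canonical_decomposition transverse_fibreE.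
split.
- apply: linear_subspaceI => [|a _ _ [v tv <-] [w tw <-]].
    by exists 0; [exact: tangent0|rewrite tmap0].
  by exists (a *: v + w); [exact: tangentD|rewrite tmapP].
- apply: linear_subspaceI => [|a _ _ [v tv <-] [w tw <-]].
    by exists 0; [exact: linear_subspace0|rewrite tmap0].
  by exists (a *: v + w); [exact: linear_subspaceP|rewrite tmapP].
- apply/seteqP; split=> [w tw|_ [_ [v tv <-] [_ [mu mmu <-] <-]]].
    have [th teta wE] := kosmann_formula triv triv' Uu U'u tw splitP.
    have [ta mb _] := splitP _ teta.
    eexists; last (eexists; [|exact: esym wE]).
      eexists; [|reflexivity]; apply: tangent_sum => //.
      by have := tmap_tangent (smooth1_at_orbit bP u 1%g) ta; rewrite act1.
    by eexists; [exact: mb|reflexivity].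
  apply: tangent_sum; first exact: tmap_tangent.
  have := tmap_tangent (smooth1_at_orbit bQ (i u) 1%g) (m_tangent mmu).
  by rewrite act1.
- apply/seteqP; split=> [_ [[v tv <-] [mu mmu E]]|_ ->].
    have [-> _] := kosmann_inter tv mmu (esym E).
    by rewrite tmap0.
  split; first by exists 0; [exact: tangent0|rewrite tmap0].
  by exists 0; [exact: linear_subspace0|rewrite tmap0].
Qed.

Lemma kosmann_unique u v v' X X' :
  tangent u v -> tangent u v' ->
  transverse_fibre bQ i m u X -> transverse_fibre bQ i m u X' ->
  tmap i u v + X = tmap i u v' + X' -> v = v' /\ X = X'.
Proof.
move=> tv tv' mX mX' E.
have [E1 E2] := direct_sum_unique (reductive_canonical_decomposition u)
  (ex_intro2 _ _ _ tv erefl) (ex_intro2 _ _ _ tv' erefl) mX mX' E.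
split=> //; apply/eqP; rewrite -subr_eq0; apply/eqP/(tmap_i_inj (u := u)).
  exact: tangent_sum tv (tangent_opp tv').
by rewrite tmapB E1 subrr.
Qed.

(* Right translation by [j a] composed with the orbit map of [i u] is the orbit
   map of [i (act bP u a)] composed with conjugation by the inverse of [j a]. *)
Lemma transverse_fibre_ract u a X : transverse_fibre bQ i m u X ->
  transverse_fibre bQ i m (act bP u a)
    (tmap (fun r => act bQ r (j a)) (i u) X).
Proof.
rewrite !transverse_fibreE => -[mu mmu <-].
have tmu := m_tangent mmu.
have [_ _ [_ Adm]] := hred.
exists (Ad (j (a^-1)%g) mu); first by apply: (Adm (a^-1)%g); exists mu.
rewrite /Ad jV.
set ja := j a; pose cj := fun h : H => (ja^-1 * h * (ja^-1)^-1)%g.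
have scj : smooth1_at cj 1%g.
  exact: smooth1_at_comp (smooth1_at_lmul _ _) (smooth1_at_rmul _ _).
have cj1 : cj 1%g = 1%g by rewrite /cj mulg1 mulgV.
have -> : tmap (act bQ (i (act bP u a))) 1%g =
    tmap (act bQ (i (act bP u a))) (cj 1%g) by rewrite cj1.
apply: etrans (esym (tmap_comp scj (smooth1_at_orbit _ _ _) tmu)) _.
have -> : tmap (fun r => act bQ r ja) (i u) =
    tmap (fun r => act bQ r ja) (act bQ (i u) 1%g) by rewrite act1.
apply: etrans _ (tmap_comp (smooth1_at_orbit bQ (i u) 1%g)
  (smooth1_at_ract _ _ _) tmu).
have -> : act bQ (i (act bP u a)) \o cj = (fun r => act bQ r ja) \o act bQ (i u).
  apply/funext => h; rewrite /= iM -!actM /cj invgK.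
  by rewrite -!mulgA mulVKg.
reflexivity.
Qed.

Variable Xi : Q -> tvec Q.
Hypothesis fXi : vector_field Xi.

Lemma kosmann_split_exists : exists (XiK : P -> tvec P) (XiG : P -> tvec Q),
  forall u, [/\ tangent u (XiK u), transverse_fibre bQ i m u (XiG u) &
    Xi (i u) = tmap i u (XiK u) + XiG u].
Proof.
have /choice[X XP] u : exists p : tvec P * tvec Q, [/\ tangent u p.1,
    transverse_fibre bQ i m u p.2 & Xi (i u) = tmap i u p.1 + p.2].
  have [_ _ E _] := reductive_canonical_decomposition u.
  have tXi : tangent (i u) (Xi (i u)) by exact: fXi.1.
  have : [set a + b | a in tmap i u @` tangent u & b in transverse_fibre bQ i m u]
    (Xi (i u)) by rewrite -E.
  by move=> [_ [v tv <-] [w mw <-]]; exists (v, w).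
by exists (fun u => (X u).1), (fun u => (X u).2).
Qed.

Section Split.
Variables (XiK : P -> tvec P) (XiG : P -> tvec Q).
Hypothesis splitXi : forall u,
  [/\ tangent u (XiK u), transverse_fibre bQ i m u (XiG u) &
    Xi (i u) = tmap i u (XiK u) + XiG u].

(** [XiK] and [XiG] are known only pointwise. The explicit formula is smooth near [u0] term by term,
    and uniqueness forces the given components to coincide with it there. *)
Lemma kosmann_field_at u0 : field_at idfun XiK u0 /\ field_at i XiG u0.
Proof.
have [alpha [beta [splitP linalpha linbeta]]] := reductive_splitting.
have [U [k [s [Uu triv]]]] := trivialization bQ (Defs.proj bQ (i u0)).
have [U' [k' [s' [U'u triv']]]] := trivialization bP (Defs.proj bP u0).
have nU : \forall u \near u0, U (Defs.proj bQ (i u)).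
  exact: ((smooth_i u0).1 _ (near_trivialized triv Uu)).
have nU' := near_trivialized triv' U'u.
pose h u := horizontal_lift bP k' s' u (tmap (Defs.proj bQ) (i u) (Xi (i u))).
pose w u := Xi (i u) - tmap i u (h u).
pose eta u := vertical_part k (i u) (w u).
have formula : \forall u \near u0,
    [/\ tangent u (h u), tangent (1%g : H) (eta u) &
    Xi (i u) = tmap i u (h u + tmap (act bP u) 1%g (alpha (eta u))) +
               tmap (act bQ (i u)) 1%g (beta (eta u))].
  apply: filterS2 nU nU' => u Uiu U'iu.
  apply: (kosmann_formula triv triv' _ U'iu (fXi.1 _) splitP).
  by rewrite -proj_i.
have fieldXi : field_at i (Xi \o i) u0.
  exact: (field_at_pullback (smooth_i u0) (vector_field_field_at (i u0) fXi)).
have fieldp : field_at (Defs.proj bP)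
    (fun u => tmap (Defs.proj bQ) (i u) (Xi (i u))) u0.
  have -> : Defs.proj bP = Defs.proj bQ \o i.
    by apply/funext => u; rewrite /= proj_i.
  by apply: field_at_tmap fieldXi; apply: nearW => q; exact: smooth1_at_proj.
have [oU' sk' ss' _ [sK' _]] := triv'; have [oU sk _ _ _] := triv.
(* The lift is a partial tangent map of [s'] whose parameter [k' u] moves with [u]; its base point
   [s' (proj u, k' u)] is [u] itself near [u0]. *)
have fieldh : field_at idfun h u0.
  have ns' : \forall z \near (Defs.proj bP u0, k' u0), smooth2_at s' z.
    exists (U', setT); first by split; [exact: open_nbhs_nbhs|exact: filterT].
    by move=> [y a] [/= U'y _]; exact: ss'.
  apply: field_at_near_eq (field_at_partial1 ns' fieldp (sk' _ U'u)).
    by apply: filterS nU' => u; exact: sK'.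
  exact: nearW.
have fieldw : field_at i w u0.
  have fieldih : field_at i (fun u => tmap i u (h u)) u0.
    by apply: (field_at_tmap _ fieldh); apply: nearW => u; exact: smooth_i.
  apply: field_at_near_eq (field_atP (-1) fieldih fieldXi); apply: nearW => // u.
  by rewrite /w scaleN1r addrC.
have ski u : U (Defs.proj bQ (i u)) -> smooth1_at (k \o i) u.
  by move=> /sk; exact: smooth1_at_comp.
have fieldk : field_at (k \o i) (fun u => tmap k (i u) (w u)) u0.
  apply: field_at_tmap fieldw.
  by apply: filterS (near_trivialized triv Uu) => q; exact: sk.
(* The left translation in [vertical_part] depends on [u], so it is treated as a partial tangent map
   of the multiplication at [((k (i u))^-1, k (i u))], along the constant map 1. *)
have fieldeta : field_at (fun=> 1%g) eta u0.
  have sV : smooth1_at (fun u => ((k (i u))^-1)%g) u0.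
    exact: smooth1_at_comp (ski _ Uu) (smooth1_at_invg _).
  have nmul : \forall z \near ((k (i u0))^-1%g, k (i u0)),
      smooth2_at (fun p : H * H => (p.1 * p.2)%g) z.
    by apply: near_pairW => -[a1 a2]; exact: smooth2_at_mulg.
  have fm := field_at_partial2 (f := fun u => ((k (i u))^-1)%g) nmul sV fieldk.
  apply: (field_at_near_eq _ _ fm).
    by apply: nearW => u; exact: mulVg.
  have [_ tw _] := fieldw.
  apply: filterS2 nU tw => u Uiu twu.
  by apply: esym; exact: (tmap_comp (sk _ Uiu) (smooth1_at_lmul _ _) twu).
have fieldalpha : field_at (fun=> 1%g) (alpha \o eta) u0.
  by apply: field_at_linear fieldeta => // v /splitP[].
have fieldbeta : field_at (fun=> 1%g) (beta \o eta) u0.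
  apply: field_at_linear fieldeta => // v /splitP[_ mb _]; exact: m_tangent.
have fieldK : field_at idfun
    (fun u => h u + tmap (act bP u) 1%g (alpha (eta u))) u0.
  have na : \forall z \near (u0, 1%g : G),
      smooth2_at (fun p : P * G => act bP p.1 p.2) z.
    by apply: near_pairW => z; exact: smooth2_at_act.
  have fo : field_at idfun (fun u => tmap (act bP u) 1%g (alpha (eta u))) u0.
    have := field_at_partial2 na (smooth1_at_id u0) fieldalpha.
    by apply: field_at_near_eq; apply: nearW => u //; exact: act1.
  apply: field_at_near_eq (field_atP 1 fieldh fo); apply: nearW => // u.
  by rewrite scale1r.
have fieldG : field_at i (fun u => tmap (act bQ (i u)) 1%g (beta (eta u))) u0.
  have na : \forall z \near (i u0, 1%g : H),
      smooth2_at (fun p : Q * H => act bQ p.1 p.2) z.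
    by apply: near_pairW => z; exact: smooth2_at_act.
  have := field_at_partial2 na (smooth_i u0) fieldbeta.
  by apply: field_at_near_eq; apply: nearW => u //; exact: act1.
(* Uniqueness is applied at each [u] near [u0], where both pairs decompose [Xi (i u)]. *)
have E : \forall u \near u0,
    h u + tmap (act bP u) 1%g (alpha (eta u)) = XiK u /\
    tmap (act bQ (i u)) 1%g (beta (eta u)) = XiG u.
  have [_ tK _] := fieldK.
  apply: filterS2 formula tK => u [th teta XE] tKu.
  have [tXK mXG XE'] := splitXi u.
  apply: (kosmann_unique tKu tXK _ mXG); last by rewrite -XE.
  have [_ mb _] := splitP _ teta.
  by rewrite transverse_fibreE; exists (beta (eta u)).
split.
  by apply: field_at_near_eq fieldK; [exact: nearW|apply: filterS E => u []].
by apply: field_at_near_eq fieldG; [exact: nearW|apply: filterS E => u []].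
Qed.

End Split.

End ReductiveStructure.

Theorem corollary4p14 (R : realType) (M P Q : manifoldType R)
    (G H : lieGroupType R)
    (bP : principal_bundle M P G) (bQ : principal_bundle M Q H)
    (j : G -> H) (i : P -> Q) (m : set (tvec H))
    (hred : reductive_structure bP bQ j i m)
    (Xi : Q -> tvec Q) (hXi : vector_field Xi)
    (hinv : invariant_field bQ Xi) :
  (forall u, canonical_decomposition bQ i m u) /\
  exists (XiK : P -> tvec P) (XiG : P -> tvec Q),
    [/\ vector_field XiK, invariant_field bP XiK,
        transverse_field bQ i m XiG
      & forall u, Xi (i u) = tmap i u (XiK u) + XiG u].
Proof.
split; first exact: (reductive_canonical_decomposition hred).
have [XiK [XiG XiP]] := kosmann_split_exists hred hXi.
have fields := kosmann_field_at hred hXi XiP.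
exists XiK, XiG; split.
- by apply: field_at_vector_field_along => u; have [] := fields u.
- move=> a u; have [tK mG XE] := XiP u; have [tKa mGa XEa] := XiP (act bP u a).
  have [[_ [sj _ _]] [[si _ _] iM _] _] := hred.
  have siu := smooth_smooth1_at openT (I : [set: P] u) si.
  have siua := smooth_smooth1_at openT (I : [set: P] (act bP u a)) si.
  have tKr := tmap_tangent (smooth1_at_ract bP a u) tK.
  have mGr := transverse_fibre_ract hred a mG.
  (* The left side is the decomposition at [u] translated by [j a]; by invariance of [Xi] it
     decomposes the same vector as the right side. *)
  suff E : tmap i (act bP u a) (tmap (fun r => act bP r a) u (XiK u)) +
      tmap (fun r => act bQ r (j a)) (i u) (XiG u) =
      tmap i (act bP u a) (XiK (act bP u a)) + XiG (act bP u a).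
    by have [] := kosmann_unique hred tKr tKa mGr mGa E.
  rewrite -XEa iM -hinv XE tmapD; apply: (congr1 (fun v => v + _)).
  apply: etrans (esym (tmap_comp (smooth1_at_ract bP a u) siua tK)) _.
  apply: etrans _ (tmap_comp siu (smooth1_at_ract bQ (j a) (i u)) tK).
  have -> : i \o (fun r => act bP r a) = (fun r => act bQ r (j a)) \o i.
    by apply/funext => r; rewrite /= iM.
  reflexivity.
- split=> [|u]; last by have [] := XiP u.
  by apply: field_at_vector_field_along => u; have [] := fields u.
- by move=> u; have [] := XiP u.
Qed.
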